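(* Let $T\to U$ be a covering of connected complex tori with character groups $\Lambda\supseteq\Gamma$ respectively, let $G=\Lambda/\Gamma$ (a finite abelian group), let $\Delta_U=\{(a_e,\chi_e)\}_{e\in E}$ be a surjective toric arrangement in $U$, and let $m_T$ be the multiplicity function of the arrangement lifted to $T$. Let $\mathcal{C}\subseteq\operatorname{Ext}^1(G,\Gamma)$ be the set of elements coherent with $\Delta_U$ and $m_T$. Then the assignment sending the class of $x\in\mathcal{C}$, corresponding to an extension $0\to\Gamma\to\Lambda_x\to G\to0$, to the covering $\operatorname{Hom}(\Lambda_x,\mathbb{C}^* )\to\operatorname{Hom}(\Gamma,\mathbb{C}^* )=U$ induces a bijection $$\mathcal{C}/\operatorname{Aut}(G)\ \longleftrightarrow\ \{T'\to U\mid m_{T'}=m_T\},$$ where the right-hand side is the set of coverings $T'\to U$ by (not necessarily connected) tori, up to isomorphism over $U$, such that the multiplicity function $m_{T'}$ of the arrangement $\Delta_U$ lifted to $T'$ equals $m_T$.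
   Context: A toric arrangement in the torus $U=\operatorname{Hom}(\Gamma,\mathbb{C}^* )$ is a finite family $\{(a_e,\chi_e)\}_{e\in E}$, $a_e\in\mathbb{C}^*$, $0\neq\chi_e\in\Gamma$ (with hypertori $\{a_e\chi_e=1\}$); it is surjective if the $\chi_e$ generate $\Gamma$. A covering $T'\to U$ means a surjective homomorphism with finite kernel from a (possibly disconnected) torus $T'=\operatorname{Hom}(\Lambda',\mathbb{C}^* )$, $\Lambda'$ a finitely generated abelian group; equivalently an injection $\Gamma\hookrightarrow\Lambda'$ with finite cokernel. Isomorphisms over $U$ are isomorphisms of algebraic groups commuting with the maps to $U$. The lifted arrangement on $T'$ is the family $(a_e,\chi_e)$ with $\chi_e$ viewed in $\Lambda'$. For $S\subseteq E$ let $\Gamma_S=\langle\chi_e\rangle_{e\in S}\subseteq\Gamma$. Multiplicity functions: $m_U(S)=|\operatorname{Tor}(\Gamma/\Gamma_S)|$ and, for a covering $T'$ with character group $\Lambda'$, $m_{T'}(S)=|\operatorname{Tor}(\Lambda'/\Gamma_S)|$, where $\operatorname{Tor}$ denotes the torsion subgroup (this is the number of connected components of the intersection of the hypertori indexed by $S$ in $U$, resp. $T'$, whenever that intersection is nonempty). Let $\operatorname{Rad}_\Gamma(\Gamma_S)=\{\gamma\in\Gamma:k\gamma\in\Gamma_S\text{ for some }k\ge1\}$ and $F_S=\Gamma/\operatorname{Rad}_\Gamma(\Gamma_S)$, a free $\mathbb{Z}$-module; let $\pi_S\colon\operatorname{Ext}^1(G,\Gamma)\to\operatorname{Ext}^1(G,F_S)$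 be the induced map. For $x\in\operatorname{Ext}^1(G,\Gamma)$ let $H_S(x)$ be the unique maximal subgroup $H$ of $G$ such that $\pi_S(x)$ restricts to $0$ in $\operatorname{Ext}^1(H,F_S)$ (such a unique maximal subgroup exists). The element $x$ is coherent with $\Delta_U$ and $m_T$ if $|H_S(x)|=m_T(S)/m_U(S)$ for all $S\subseteq E$. The group $\operatorname{Aut}(G)$ acts naturally on $\operatorname{Ext}^1(G,\Gamma)$ on the right, preserving $\mathcal{C}$. *)

(* Defs.v *)
From HB Require Import structures.
From mathcomp Require Import all_boot all_algebra all_fingroup finmap.
From mathcomp Require Import boolp classical_sets functions cardinality reals.
From mathcomp Require Import complex.
Import GRing.Theory.

Set Implicit Arguments.
Unset Strict Implicit.
Unset Printing Implicit Defensive.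

Local Open Scope ring_scope.
Local Open Scope quotient_scope.

Definition class_in (X : Type) (A : X -> Prop) (r : X -> X -> Prop) (x : X) :
  X -> Prop := fun y => A y /\ r x y.

Definition quot_set (X : Type) (A : X -> Prop) (r : X -> X -> Prop) : Type :=
  {c : X -> Prop | exists2 x, A x & c = class_in A r x}.

Definition quot_class (X : Type) (A : X -> Prop) (r : X -> X -> Prop) (x : X)
    (Ax : A x) : quot_set A r :=
  exist _ (class_in A r x) (ex_intro2 _ _ x Ax erefl).

Definition fin_gen (L : zmodType) : Prop :=
  exists (n : nat) (g : 'I_n -> L),
    forall l, exists c : 'I_n -> int, l = \sum_i g i *~ c i.

Definition free_fin_rank (L : zmodType) : Prop :=
  exists (n : nat) (f : {additive L -> 'rV[int]_n}), bijective f.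

Definition torsion (L : zmodType) : set L :=
  [set l | exists2 k : nat, (0 < k)%N & l *+ k = 0]%classic.

Section Span.
Variables (L : zmodType) (E : finType) (chi : E -> L) (S : {set E}).

(* The subgroup Gamma_S generated by the chi e for e in S *)
Definition char_span : {pred L} :=
  fun l => `[< exists c : E -> int, l = \sum_(e in S) chi e *~ c e >].

Lemma char_spanP l :
  reflect (exists c : E -> int, l = \sum_(e in S) chi e *~ c e) (l \in char_span).
Proof. exact: asboolP. Qed.

Lemma char_span_zmod_closed : zmod_closed char_span.
Proof.
split=> [|x y].
  by apply/char_spanP; exists (fun=> 0); rewrite big1 // => e _; rewrite mulr0z.
move=> /char_spanP[c ->] /char_spanP[d ->]; apply/char_spanP.
exists (fun e => c e - d e); rewrite -sumrB.
by apply: eq_bigr => e _; rewrite mulrzBr.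
Qed.

HB.instance Definition _ :=
  GRing.isZmodClosed.Build L char_span char_span_zmod_closed.

Definition radical : {pred L} :=
  fun l => `[< exists2 k : nat, (0 < k)%N & l *+ k \in char_span >].

Lemma radicalP l :
  reflect (exists2 k : nat, (0 < k)%N & l *+ k \in char_span) (l \in radical).
Proof. exact: asboolP. Qed.

Lemma radical_zmod_closed : zmod_closed radical.
Proof.
split=> [|x y].
  by apply/radicalP; exists 1%N => //; rewrite mul0rn rpred0.
move=> /radicalP[k k0 xk] /radicalP[m m0 ym]; apply/radicalP.
exists (k * m)%N; first by rewrite muln_gt0 k0.
rewrite mulrnBl rpredB //; first by rewrite mulrnA rpredMn.
by rewrite mulnC mulrnA rpredMn.
Qed.

HB.instance Definition _ :=
  GRing.isZmodClosed.Build L radical radical_zmod_closed.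

Definition quot_char_span : zmodType := Quotient.quot char_span.

(* F_S *)
Definition quot_radical : zmodType := Quotient.quot radical.

Definition proj_radical : {additive L -> quot_radical} :=
  \pi_(Quotient.quot radical).

End Span.

(* Ext^1(G, A), for abelian groups, is realized as the group of normalized
   symmetric 2-cocycles (factor sets) modulo coboundaries; the extension of G
   by A given by a factor set is [extension] below. *)

Section Ext.
Variables (G : finZmodType) (A : zmodType).

Definition is_cocycle : {pred {ffun G * G -> A}} := fun f =>
  [&& [forall a, f (0, a) == 0],
      [forall a, forall b, f (a, b) == f (b, a)] &
      [forall a, forall b, forall c,
        f (b, c) + f (a, b + c) == f (a, b) + f (a + b, c)]].

Lemma is_cocycleP (f : {ffun G * G -> A}) :
  reflect [/\ forall a, f (0, a) = 0, forall a b, f (a, b) = f (b, a) &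
              forall a b c, f (b, c) + f (a, b + c) = f (a, b) + f (a + b, c)]
          (f \in is_cocycle).
Proof.
apply: (iffP and3P) => -[f0 fC fA]; split.
- by move=> a; apply/eqP/(forallP f0).
- by move=> a b; apply/eqP/(forallP (forallP fC a)).
- by move=> a b c; apply/eqP/(forallP (forallP (forallP fA a) b)).
- by apply/forallP => a; apply/eqP.
- by apply/forallP => a; apply/forallP => b; apply/eqP.
- by do 3![apply/forallP => ?]; apply/eqP.
Qed.

Lemma cocycle_zmod_closed : zmod_closed is_cocycle.
Proof.
split=> [|f g].
  by apply/is_cocycleP; split=> *; rewrite !ffunE // !addr0.
move=> /is_cocycleP[f0 fC fA] /is_cocycleP[g0 gC gA].
apply/is_cocycleP; split=> [a|a b|a b c]; rewrite !ffunE.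
- by rewrite f0 g0 subr0.
- by rewrite fC gC.
- by rewrite addrACA -opprD fA gA opprD addrACA.
Qed.

HB.instance Definition _ :=
  GRing.isZmodClosed.Build {ffun G * G -> A} is_cocycle cocycle_zmod_closed.

Record cocycle : predArgType :=
  Cocycle { cocycle_val :> {ffun G * G -> A}; _ : cocycle_val \in is_cocycle }.

HB.instance Definition _ := [isSub for cocycle_val].
HB.instance Definition _ := [Choice of cocycle by <:].
HB.instance Definition _ := [SubChoice_isSubZmodule of cocycle by <:].

Definition is_coboundary : {pred cocycle} := fun f =>
  `[< exists h : G -> A, forall a b, f (a, b) = h a + h b - h (a + b) >].

Lemma is_coboundaryP (f : cocycle) :
  reflect (exists h : G -> A, forall a b, f (a, b) = h a + h b - h (a + b))
          (f \in is_coboundary).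
Proof. exact: asboolP. Qed.

Lemma coboundary_zmod_closed : zmod_closed is_coboundary.
Proof.
split=> [|f g].
  apply/is_coboundaryP; exists (fun=> 0) => a b.
  by rewrite ffunE addr0 subr0.
move=> /is_coboundaryP[h hf] /is_coboundaryP[k kg]; apply/is_coboundaryP.
exists (fun a => h a - k a) => a b.
rewrite !ffunE hf kg [h a - k a + _]addrACA -opprD.
by rewrite [- (h _ - _)]opprD addrACA -opprD.
Qed.

HB.instance Definition _ :=
  GRing.isZmodClosed.Build cocycle is_coboundary coboundary_zmod_closed.

Definition Ext1 : zmodType := Quotient.quot is_coboundary.

Definition Ext1_class (f : cocycle) : Ext1 := \pi_(Quotient.quot is_coboundary) f.

Definition Ext1_repr (x : Ext1) : cocycle :=
  generic_quotient.repr (x : Quotient.quot is_coboundary).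

Lemma Ext1_reprK : cancel Ext1_repr Ext1_class.
Proof. exact: reprK. Qed.

Lemma Ext1_classP (f g : cocycle) :
  reflect (exists h : G -> A,
             forall a b, f (a, b) - g (a, b) = h a + h b - h (a + b))
          (Ext1_class f == Ext1_class g).
Proof.
rewrite /Ext1_class -Quotient.idealrBE.
by apply: (iffP (is_coboundaryP _)) => -[h hE]; exists h => a b;
  have := hE a b; rewrite !ffunE.
Qed.

End Ext.

Section Functoriality.
Variables (G H : finZmodType) (A B : zmodType).

Lemma cocycle_push_proof (phi : {additive A -> B}) (f : cocycle G A) :
  [ffun ab : G * G => phi (f ab)] \in @is_cocycle G B.
Proof.
have /is_cocycleP[f0 fC fA] := valP f.
apply/is_cocycleP; split=> [a|a b|a b c]; rewrite !ffunE.
- by rewrite [f _]f0 raddf0.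
- by rewrite [f _]fC.
- by rewrite -!raddfD [_ + _]fA.
Qed.

Definition cocycle_push (phi : {additive A -> B}) (f : cocycle G A) :
  cocycle G B := Cocycle (cocycle_push_proof phi f).

Lemma cocycle_pull_proof (u : {additive H -> G}) (f : cocycle G A) :
  [ffun ab : H * H => f (u ab.1, u ab.2)] \in @is_cocycle H A.
Proof.
have /is_cocycleP[f0 fC fA] := valP f.
apply/is_cocycleP; split=> [a|a b|a b c]; rewrite !ffunE /=.
- by rewrite raddf0 [f _]f0.
- by rewrite [f _]fC.
- by rewrite !raddfD [_ + _]fA.
Qed.

Definition cocycle_pull (u : {additive H -> G}) (f : cocycle G A) :
  cocycle H A := Cocycle (cocycle_pull_proof u f).

Definition Ext1_push (phi : {additive A -> B}) (x : Ext1 G A) : Ext1 G B :=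
  Ext1_class (cocycle_push phi (Ext1_repr x)).

Definition Ext1_pull (u : {additive H -> G}) (x : Ext1 G A) : Ext1 H A :=
  Ext1_class (cocycle_pull u (Ext1_repr x)).

(* Neither map depends on the choice of representatives. *)
Lemma Ext1_push_class (phi : {additive A -> B}) (f : cocycle G A) :
  Ext1_push phi (Ext1_class f) = Ext1_class (cocycle_push phi f).
Proof.
have /eqP/Ext1_classP[h hE] := Ext1_reprK (Ext1_class f).
apply/eqP/Ext1_classP; exists (phi \o h) => a b.
by rewrite !ffunE /= -raddfB hE raddfB raddfD.
Qed.

Lemma Ext1_pull_class (u : {additive H -> G}) (f : cocycle G A) :
  Ext1_pull u (Ext1_class f) = Ext1_class (cocycle_pull u f).
Proof.
have /eqP/Ext1_classP[h hE] := Ext1_reprK (Ext1_class f).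
apply/eqP/Ext1_classP; exists (h \o u) => a b.
by rewrite !ffunE /= hE raddfD.
Qed.

End Functoriality.

Section Subgroup.
Variables (G : finZmodType) (H : {group G}).

Definition in_group : {pred G} := fun a => a \in H.

Lemma in_group_zmod_closed : zmod_closed in_group.
Proof.
split=> [|a b aH bH]; first exact: (group1 H).
exact: (groupM aH (groupVr bH)).
Qed.

HB.instance Definition _ :=
  GRing.isZmodClosed.Build G in_group in_group_zmod_closed.

(* [{group G}] is the type of MathComp subgroups of (G, +); restricting
   extension classes needs H as a finZmodType. *)
Record subgroup : predArgType :=
  Subgroup { subgroup_val :> G; _ : subgroup_val \in in_group }.

HB.instance Definition _ := [isSub for subgroup_val].
HB.instance Definition _ := [Finite of subgroup by <:].
HB.instance Definition _ := [SubChoice_isSubZmodule of subgroup by <:].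

Definition Ext1_restr (A : zmodType) (x : Ext1 G A) : Ext1 subgroup A :=
  Ext1_pull (val : {additive subgroup -> G}) x.

End Subgroup.

(* Elements of Aut(G) are the bijective additive endomaps of G; they act on the
   right of Ext^1(G, A) by pullback. *)
Definition same_orbit (G : finZmodType) (A : zmodType) (x y : Ext1 G A) : Prop :=
  exists2 u : {additive G -> G}, bijective u & y = Ext1_pull u x.

(* The addition depends on the cocycle, which is thus a (phantom) parameter of
   the type. *)
Definition extension (G : finZmodType) (A : zmodType) (f : cocycle G A) : Type :=
  (A * G)%type.

Section ExtensionGroup.
Variables (G : finZmodType) (A : zmodType) (f : cocycle G A).
Local Notation ext := (extension f).

HB.instance Definition _ := Choice.copy ext (A * G)%type.

Let ext_add (s t : ext) : ext :=
  (s.1 + t.1 + f (s.2, t.2), s.2 + t.2).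
Let ext_opp (s : ext) : ext := (- s.1 - f (s.2, - s.2), - s.2).
Let ext_zero : ext := (0, 0).

Let ext_addA : associative ext_add.
Proof.
have /is_cocycleP[_ _ fA] := valP f.
move=> [x a] [y b] [z c]; congr pair => /=; last by rewrite addrA.
have := fA a b c => /= fabc.
by rewrite -!addrA fabc !addrA [x + y + z + _]addrAC.
Qed.

Let ext_addC : commutative ext_add.
Proof.
have /is_cocycleP[_ fC _] := valP f.
move=> [x a] [y b]; congr pair => /=; last exact: addrC.
by rewrite [f _]fC [x + y]addrC.
Qed.

Let ext_add0 : left_id ext_zero ext_add.
Proof.
have /is_cocycleP[f0 _ _] := valP f.
by move=> [x a]; congr pair; rewrite /= ?[f _]f0 ?add0r ?addr0.
Qed.

Let ext_addN : left_inverse ext_zero ext_opp ext_add.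
Proof.
have /is_cocycleP[_ fC _] := valP f.
move=> [x a]; congr pair => /=; last exact: addNr.
by rewrite [f (- a, a)]fC addrAC addrNK addNr.
Qed.

HB.instance Definition _ :=
  GRing.isZmodule.Build ext ext_addA ext_addC ext_add0 ext_addN.

Definition extension_incl (x : A) : ext := (x, 0).

Lemma extension_incl_is_zmod_morphism : zmod_morphism extension_incl.
Proof.
have /is_cocycleP[f0 _ _] := valP f.
move=> x y; rewrite /extension_incl; congr pair; rewrite /= ?subr0 //.
by rewrite oppr0 ![f _]f0 subr0 addr0.
Qed.

HB.instance Definition _ :=
  GRing.isZmodMorphism.Build A ext extension_incl extension_incl_is_zmod_morphism.

Definition extension_proj (s : ext) : G := s.2.

Lemma extension_proj_is_zmod_morphism : zmod_morphism extension_proj.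
Proof. by []. Qed.

HB.instance Definition _ :=
  GRing.isZmodMorphism.Build ext G extension_proj extension_proj_is_zmod_morphism.

Lemma extension_exact :
  [/\ injective extension_incl, forall a, exists s, extension_proj s = a
    & forall s, extension_proj s = 0 <-> exists x, s = extension_incl x].
Proof.
split=> [x y [] //|a|[x a]]; first by exists (0, a).
by split=> [/= ->|[y [_ ->]]//]; exists x.
Qed.

End ExtensionGroup.

Section Tori.
Variable R : realType.
Local Notation C := R[i].

(* Hom(L, C^* ) *)
Record torus (L : zmodType) : Type := Torus {
  torus_fun :> L -> C;
  _ : forall l, torus_fun l != 0;
  _ : {morph torus_fun : l m / l + m >-> l * m}
}.

Section TorusGroup.
Variable L : zmodType.

HB.instance Definition _ := gen_eqMixin (torus L).
HB.instance Definition _ := gen_choiceMixin (torus L).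

Lemma torus_neq0 (t : torus L) l : t l != 0. Proof. by case: t. Qed.

Lemma torusD (t : torus L) : {morph t : l m / l + m >-> l * m}.
Proof. by case: t. Qed.

Lemma torus_ext (t u : torus L) : t =1 u -> t = u.
Proof.
case: t u => [t t0 tM] [u u0 uM] /= /funext tu; rewrite -{}tu in u0 uM *.
by congr Torus; exact: Prop_irrelevance.
Qed.

Definition torus_one : torus L.
Proof.
by exists (fun=> 1) => [_|l m]; rewrite ?oner_neq0 ?mulr1.
Defined.

Definition torus_mul (t u : torus L) : torus L.
Proof.
exists (fun l => t l * u l) => [l|l m].
  by rewrite mulf_neq0 ?torus_neq0.
by rewrite !torusD mulrACA.
Defined.

Definition torus_inv (t : torus L) : torus L.
Proof.
exists (fun l => (t l)^-1) => [l|l m].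
  by rewrite invr_neq0 ?torus_neq0.
by rewrite torusD invfM.
Defined.

Let torus_mulA : associative torus_mul.
Proof. by move=> t u v; apply: torus_ext => l /=; rewrite mulrA. Qed.
Let torus_mul1 : left_id torus_one torus_mul.
Proof. by move=> t; apply: torus_ext => l /=; rewrite mul1r. Qed.
Let torus_mulr1 : right_id torus_one torus_mul.
Proof. by move=> t; apply: torus_ext => l /=; rewrite mulr1. Qed.
Let torus_mulV : left_inverse torus_one torus_inv torus_mul.
Proof. by move=> t; apply: torus_ext => l /=; rewrite mulVf ?torus_neq0. Qed.
Let torus_mulrV : right_inverse torus_one torus_inv torus_mul.
Proof. by move=> t; apply: torus_ext => l /=; rewrite mulfV ?torus_neq0. Qed.

HB.instance Definition _ := isGroup.Build (torus L)
  torus_mulA torus_mul1 torus_mulr1 torus_mulV torus_mulrV.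

(* The coordinate ring of the torus Hom(L, C^* ) is the group algebra C[L]: the
   regular functions are the linear combinations of characters. *)
Definition regular (phi : torus L -> C) : Prop :=
  exists (n : nat) (c : 'I_n -> C) (l : 'I_n -> L),
    forall t, phi t = \sum_i c i * t (l i).

End TorusGroup.

Definition algebraic_hom (L M : zmodType) (f : torus L -> torus M) : Prop :=
  {morph f : s t / (s * t)%g >-> (s * t)%g} /\
  forall phi : torus M -> C, regular phi -> regular (phi \o f).

Definition dual_map (L M : zmodType) (i : {additive M -> L}) (t : torus L) :
  torus M.
Proof.
exists (t \o i) => [m|m n] /=; first exact: torus_neq0.
by rewrite raddfD torusD.
Defined.

Record torus_over (Gam : zmodType) := TorusOver {
  chars : zmodType;
  cov_map : torus chars -> torus Gam
}.
Arguments cov_map {Gam} t _.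

Section Coverings.
Variable Gam : zmodType.
Implicit Types X Y : torus_over Gam.

Definition covering X : Prop :=
  [/\ fin_gen (chars X),
      algebraic_hom (cov_map X),
      forall u, exists t, cov_map X t = u
    & finite_set [set t | cov_map X t = 1%g]%classic].

Definition iso_over X Y : Prop :=
  exists (f : torus (chars X) -> torus (chars Y))
         (g : torus (chars Y) -> torus (chars X)),
    [/\ algebraic_hom f, algebraic_hom g, cancel f g, cancel g f
      & forall t, cov_map Y (f t) = cov_map X t].

(* The inclusion Gam -> Lambda' of character groups: g is sent to the unique
   character of the torus of X that is the composition of g with the covering
   map. *)
Definition pull_char X (g : Gam) : chars X :=
  xget 0 [set l | forall t, cov_map X t g = t l]%classic.

End Coverings.

Record arrangement (L : zmodType) (E : finType) := Arrangement {
  coef : E -> C;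
  charac : E -> L
}.
Arguments coef {L E} a _.
Arguments charac {L E} a _.

Section Arrangements.
Variables (L : zmodType) (E : finType).
Implicit Type D : arrangement L E.

Definition toric_arrangement D : Prop :=
  forall e, coef D e != 0 /\ charac D e != 0.

Definition surjective_arrangement D : Prop :=
  forall l, l \in char_span (charac D) [set: E].

(* #|fset_set A| is the cardinality of A when A is finite; the torsion
   subgroup below is finite when L is finitely generated. *)
Definition multiplicity D (S : {set E}) : nat :=
  #|` fset_set (@torsion (quot_char_span (charac D) S))|.

Section Coherent.
Variables (G : finZmodType) (D : arrangement L E) (mT : {set E} -> nat).

(* pi_S x restricts to 0 in Ext^1(H, F_S) *)
Definition splits_on (x : Ext1 G L) (S : {set E}) (H : {group G}) : bool :=
  Ext1_restr H (Ext1_push (proj_radical (charac D) S) x) == 0.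

(* H is the unique maximal subgroup on which pi_S x splits, that is H_S(x). *)
Definition is_H (x : Ext1 G L) (S : {set E}) (H : {group G}) : Prop :=
  maxgroup H (splits_on x S) /\
  forall K : {group G}, maxgroup K (splits_on x S) -> K = H.

Definition coherent (x : Ext1 G L) : Prop :=
  forall S : {set E}, exists2 H : {group G}, is_H x S H &
    #|H|%:R = (mT S)%:R / (multiplicity D S)%:R :> rat.

End Coherent.

End Arrangements.

Section Lifts.
Variables (Gam : zmodType) (E : finType) (D : arrangement Gam E).

Definition lift_arrangement (X : torus_over Gam) : arrangement (chars X) E :=
  Arrangement (coef D) (fun e => pull_char X (charac D e)).

Definition covering_with_multiplicity (mT : {set E} -> nat)
    (X : torus_over Gam) : Prop :=
  covering X /\ multiplicity (lift_arrangement X) =1 mT.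

End Lifts.

(* Hom(Lambda_x, C^* ) -> Hom(Gam, C^* ) *)
Definition extension_torus (G : finZmodType) (Gam : zmodType)
    (x : Ext1 G Gam) : torus_over Gam :=
  TorusOver (dual_map (@extension_incl G Gam (Ext1_repr x))).

End Tori.

(* Main.v *)
Require Import Defs.
From HB Require Import structures.
From mathcomp Require Import all_boot all_order all_algebra all_fingroup finmap.
From mathcomp Require Import cyclic.
From mathcomp Require Import boolp classical_sets functions cardinality.
From mathcomp Require Import reals complex.
Import Order.TTheory GRing.Theory Num.Theory.

(* Let Lambda' be the character group of a covering torus, i : Gam -> Lambda'
   the inclusion, with cokernel G, and Gam_S the span of the characters in S.
   - Characters of a torus are linearly independent and separate points, so
     homomorphisms of tori over U are dual to homomorphisms of character groups
     under Gam; isomorphism over U of the coverings of x and y is therefore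
     isomorphism of extensions up to Aut(G).
   - pi_S x splits on a subgroup K iff K lies in the image H_S of
     Rad_Lambda'(Gam_S), because a section over K takes torsion values in
     Lambda' / Rad_Gam(Gam_S).  As Tor(Lambda'/Gam_S) is an extension of H_S by
     Tor(Gam/Gam_S), coherence of x means that the multiplicities agree.
   - Surjectivity onto classes of coverings needs Lambda'/Gam ~ Lambda/Gam.
     The empty set has multiplicity 1, so Lambda' is a lattice.  For linearly
     independent S with |S| = k, the gcd of the k-minors of the coordinates of
     the characters in S is the multiplicity of S; hence the multiplicities
     determine the determinantal divisors, and so the Smith normal form, of the
     inclusion of Gam in Lambda'. *)

Set Implicit Arguments.
Unset Strict Implicit.
Unset Printing Implicit Defensive.

Local Open Scope ring_scope.

(** * Bijections between sets of classes *)

Lemma quot_set_bijection (X Y : Type) (A : X -> Prop) (B : Y -> Prop)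
    (r : X -> X -> Prop) (s : Y -> Y -> Prop) (F : X -> Y) :
  (forall y, s y y) -> (forall y z, s y z -> s z y) ->
  (forall x y z, s x y -> s y z -> s x z) ->
  (forall x, A x -> B (F x)) ->
  (forall x y, r x y <-> s (F x) (F y)) ->
  (forall y, B y -> exists2 x, A x & s (F x) y) ->
  exists Phi : quot_set A r -> quot_set B s,
    bijective Phi /\
    forall x (Ax : A x), sval (Phi (quot_class r Ax)) (F x).
Proof.
move=> s_refl s_sym s_trans AB rs surj.
have class_eq (y z : Y) : s y z -> class_in B s y = class_in B s z.
  move=> yz; apply/predeqP => t; split=> -[Bt st]; split=> //.
    exact: s_trans (s_sym _ _ yz) st.
  exact: s_trans yz st.
(* [r] is the pullback of [s] along [F], so it inherits the laws of an equivalence relation. *)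
have rclass_eq (x y : X) : r x y -> class_in A r x = class_in A r y.
  move=> /rs xy; apply/predeqP => t; split=> -[At /rs st]; split=> //; apply/rs.
    exact: s_trans (s_sym _ _ xy) st.
  exact: s_trans xy st.
have quot_eq Z (C : Z -> Prop) q (c d : quot_set C q) : sval c = sval d -> c = d.
  case: c d => c hc [d hd] /= cd; rewrite -{}cd in hd *.
  by congr exist; exact: Prop_irrelevance.
(* A class is only a predicate: a representative is extracted by choice, and likewise [rq] on the
   other side and the preimage [pre] up to [s]. *)
pose rp (c : quot_set A r) : X := s2val (cid2 (svalP c)).
have Arp c : A (rp c) by exact: s2valP (cid2 (svalP c)).
have rpE c : sval c = class_in A r (rp c) by exact: s2valP' (cid2 (svalP c)).
pose Phi (c : quot_set A r) : quot_set B s := quot_class s (AB _ (Arp c)).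
pose rq (d : quot_set B s) : Y := s2val (cid2 (svalP d)).
have Brq d : B (rq d) by exact: s2valP (cid2 (svalP d)).
have rqE d : sval d = class_in B s (rq d) by exact: s2valP' (cid2 (svalP d)).
pose pre d : X := s2val (cid2 (surj _ (Brq d))).
have Apre d : A (pre d) by exact: s2valP (cid2 (surj _ (Brq d))).
have preE d : s (F (pre d)) (rq d) by exact: s2valP' (cid2 (surj _ (Brq d))).
have rp_class x (Ax : A x) : r (rp (quot_class r Ax)) x.
  have : class_in A r x x by split=> //; apply/rs.
  by have /= -> := rpE (quot_class r Ax) => -[].
exists Phi; split; last first.
  move=> x Ax; split; first exact: (AB _ Ax).
  by apply/rs; exact: rp_class.
exists (fun d => quot_class r (Apre d)) => [c|d]; apply: quot_eq.
  rewrite [RHS]rpE; apply: rclass_eq; apply/rs.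
  apply: s_trans (preE _) _; apply: (s_sym _ _).
  have : class_in B s (F (rp c)) (F (rp c)) by split; [exact/AB/Arp|].
  by have /= -> := rqE (Phi c) => -[_ /s_sym].
rewrite [RHS]rqE; apply: class_eq; apply: s_trans (preE d).
by apply/rs; exact: rp_class.
Qed.

(** * Characters of tori *)

Section TorusCharacters.
Variable R : realType.
Local Notation C := R[i].
Implicit Types L M : zmodType.

Lemma torus0 L (t : torus R L) : t 0 = 1.
Proof.
apply: (mulfI (torus_neq0 t 0)); by rewrite -torusD addr0 mulr1.
Qed.

Lemma torusN L (t : torus R L) l : t (- l) = (t l)^-1.
Proof.
apply: (mulfI (torus_neq0 t l)).
by rewrite -torusD addrN torus0 mulfV ?torus_neq0.
Qed.

Lemma torusMn L (t : torus R L) l n : t (l *+ n) = t l ^+ n.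
Proof. by elim: n => [|n IHn]; rewrite ?torus0 // mulrS torusD IHn exprS. Qed.

(* Artin: subtracting chi_n(s) f(t) from f(st) shortens the combination,
   provided f(s) <> chi_n(s). *)
Lemma character_independence L n (f : torus R L -> C) (c : 'I_n -> C)
    (l : 'I_n -> L) :
  (forall s t, f (s * t)%g = f s * f t) -> f 1%g = 1 ->
  (forall t, f t = \sum_i c i * t (l i)) ->
  exists i, forall t, f t = t (l i).
Proof.
move=> fM f1; elim: n c l => [|n IHn] c l fE.
  by have := fE 1%g; rewrite big_ord0 f1 => /eqP; rewrite oner_eq0.
have [fl|/existsNP[s /eqP fs]] := EM (forall t, f t = t (l ord_max)).
  by exists ord_max.
have nz : f s - s (l ord_max) != 0 by rewrite subr_eq0.
pose w := widen_ord (leqnSn n).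
have [t|i fi] := IHn (fun i => (f s - s (l ord_max))^-1 *
    (c (w i) * (s (l (w i)) - s (l ord_max)))) (fun i => l (w i)).
  apply: (mulfI nz); rewrite big_distrr /=.
  under eq_bigr => i _ do rewrite -!mulrA mulVKf //.
  rewrite mulrBl -fM !fE big_distrr /= -sumrB big_ord_recr /=.
  rewrite [X in _ + X](_ : _ = 0) ?addr0.
    by apply: eq_bigr => i _; rewrite mulrBl mulrBr (mulrCA (s _)).
  by rewrite mulrCA subrr.
by exists (w i).
Qed.

(** Evaluation at [m] is a regular function, so its pullback along [f] is a multiplicative linear
    combination of characters; independence reduces it to a single one. *)
Lemma algebraic_hom_dual L M (f : torus R L -> torus R M) :
  algebraic_hom f -> forall m, exists l, forall t, f t m = t l.
Proof.
move=> [fM freg] m.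
have [|n [c [l fE]]] := freg (fun u => u m).
  exists 1%N, (fun=> 1), (fun=> m) => t.
  by rewrite big_ord_recl big_ord0 addr0 mul1r.
have f1 : f 1%g = 1%g.
  by apply: (@mulgI _ (f 1%g)); rewrite -fM !mulg1.
have [s t||i fi] := @character_independence L n (fun t => f t m) c l _ _ fE.
- by rewrite fM.
- by rewrite f1.
- by exists (l i).
Qed.

End TorusCharacters.

(** * Extending characters *)

(** The exponents [n] with [g *~ n] in [K] form an ideal of the integers; [d] is its generator,
    hence 0 when [g] has infinite order modulo [K]. *)
Lemma multiples_dvdz (L : zmodType) (K : zmodClosed L) (g : L) :
  exists d : nat, forall n : int, (g *~ n \in K) = (d %| n)%Z.
Proof.
have [exP|noP] := EM (exists n : nat, (0 < n)%N && (g *+ n \in K)); last first.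
  exists 0%N => n; rewrite dvd0z; apply/idP/eqP => [|->]; last first.
    by rewrite mulr0z rpred0.
  case: (intP n) => // k Kk; case: noP; exists k.+1 => //=.
  by rewrite mulrNz rpredN in Kk.
case: (ex_minnP exP) => d /andP[d0 Kd] dmin; exists d => n.
apply/idP/dvdz_mod0P => [Kn|/dvdz_mod0P/dvdzP[q ->]]; last first.
  by rewrite mulrC mulrzA rpredMz.
have Kr : g *~ (n %% d)%Z \in K.
  by rewrite /modz mulrzBr rpredB // mulrC mulrzA rpredMz.
have : (0 <= (n %% d)%Z)%R by rewrite modz_ge0 // eqz_nat gtn_eqF.
have : ((n %% d)%Z < d)%R by rewrite ltz_pmod.
case: (n %% d)%Z Kr => // -[//|k] Kk kd _.
by have := dmin k.+1 Kk; rewrite leqNgt -ltz_nat kd.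
Qed.

Section Adjoin.
Variables (L : zmodType) (K : zmodClosed L) (g : L).

(** The subgroup K + Zg; characters are extended to it one generator [g] at a time. *)
Definition adjoin : {pred L} := fun x => `[< exists n : int, x - g *~ n \in K >].

Lemma adjoinP x : reflect (exists n : int, x - g *~ n \in K) (x \in adjoin).
Proof. exact: asboolP. Qed.

Lemma adjoin_closed : zmod_closed adjoin.
Proof.
split=> [|x y /adjoinP[m xm] /adjoinP[n yn]]; apply/adjoinP.
  by exists 0; rewrite subr0 rpred0.
exists (m - n); rewrite mulrzBr opprB addrACA [- y - _]addrC addrACA.
by rewrite -[_ - y]opprB rpredB.
Qed.

HB.instance Definition _ := GRing.isZmodClosed.Build L adjoin adjoin_closed.

Lemma sub_adjoin : {subset K <= adjoin}.
Proof. by move=> x Kx; apply/adjoinP; exists 0; rewrite subr0. Qed.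

Lemma mem_adjoin : g \in adjoin.
Proof. by apply/adjoinP; exists 1; rewrite subrr rpred0. Qed.

End Adjoin.

Section CharacterExtension.
Variables (R : realType) (L : zmodType).
Local Notation C := R[i].
Implicit Types (K : zmodClosed L) (phi : L -> C).

(** [phi] is a total function with arbitrary values outside [K], so that enlarging [K] changes no
    type. *)
Definition partial_char K phi : Prop :=
  {in K, forall x, phi x != 0} /\ {in K &, {morph phi : x y / x + y >-> x * y}}.

Lemma partial_char0 K phi : partial_char K phi -> phi 0 = 1.
Proof.
move=> [nz M]; apply: (mulfI (nz 0 (rpred0 K))).
by rewrite -M ?rpred0 // addr0 mulr1.
Qed.

Lemma partial_charMz K phi x (n : int) :
  partial_char K phi -> x \in K -> phi (x *~ n) = phi x ^ n.
Proof.
move=> cphi Kx; have [nz M] := cphi.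
have Mn k : phi (x *+ k) = phi x ^+ k.
  elim: k => [|k IHk]; first by rewrite (partial_char0 cphi).
  by rewrite mulrS M ?rpredMn // IHk exprS.
case: (intP n) => [|k|k]; first by rewrite (partial_char0 cphi).
  exact: Mn.
apply: (mulfI (nz _ (rpredMn k.+1 Kx))).
rewrite mulrNz -M ?rpredN ?rpredMn // addrN (partial_char0 cphi) Mn.
by rewrite -exprnN mulfV // expf_neq0 // nz.
Qed.

Lemma root_exists (z : C) n :
  z != 0 -> (0 < n)%N -> exists2 c : C, c != 0 & c ^+ n = z.
Proof.
move=> nz n0.
have /closed_rootP[c] : size ('X^n - z%:P) != 1%N.
  by rewrite size_XnsubC //; case: n n0.
rewrite /root !hornerE subr_eq0 => /eqP cz; exists c => //.
by apply: contra_neq nz => c0; rewrite -cz c0 expr0n gtn_eqF.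
Qed.

(** The root is one of 1 + X + ... + X^(n-1), whose value at 1 is n, nonzero in characteristic 0. *)
Lemma nontrivial_root_of_unity n :
  (1 < n)%N -> exists2 c : C, c != 1 & c ^+ n = 1.
Proof.
move=> n1; have : size (\sum_(i < n) ('X : {poly C}) ^+ i) != 1%N.
  have -> : \sum_(i < n) ('X : {poly C}) ^+ i = \poly_(i < n) 1.
    by rewrite poly_def; apply: eq_bigr => i _; rewrite scale1r.
  by rewrite size_poly_eq ?oner_neq0 // gtn_eqF.
case/closed_rootP => c; rewrite /root horner_sum => /eqP cs; exists c.
  apply: contra_eq_neq cs => ->.
  under eq_bigr => i _ do rewrite !hornerE expr1n.
  by rewrite sumr_const card_ord pnatr_eq0 gtn_eqF // ltnW.
apply/eqP; rewrite -subr_eq0 subrX1.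
rewrite (eq_bigr (fun i : 'I_n => 'X^i.[c])) => [|i _]; last by rewrite hornerXn.
by rewrite cs mulr0.
Qed.

(** If [d] generates the exponents that bring [g] into [K], a [d]-th root of [phi (g *~ d)] is a
    compatible value for [g]; for d = 0 only the exponent 0 imposes a condition, and 1 satisfies
    it. *)
Lemma partial_char_value K phi g : partial_char K phi ->
  exists2 c : C, c != 0 & forall n : int, g *~ n \in K -> phi (g *~ n) = c ^ n.
Proof.
move=> cphi; have [nz M] := cphi.
have [d Kd] := multiples_dvdz K g.
have [d0|d0] := posnP d.
  exists 1 => [|n]; first exact: oner_neq0.
  rewrite Kd d0 dvd0z => /eqP->; exact: partial_char0 cphi.
have Kgd : g *~ d \in K by rewrite Kd.
have [c c0 cd] := root_exists (nz _ Kgd) d0.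
exists c => // n; rewrite Kd => /dvdzP[q ->].
by rewrite mulrC mulrzA (partial_charMz _ cphi Kgd) -cd exprnP exprz_exp.
Qed.

Lemma partial_char_extend1 K phi g c :
  partial_char K phi -> c != 0 ->
  (forall n : int, g *~ n \in K -> phi (g *~ n) = c ^ n) ->
  exists phi' : L -> C,
    [/\ partial_char (adjoin K g) phi', {in K, phi' =1 phi} & phi' g = c].
Proof.
move=> cphi c0 gc; have [nz M] := cphi.
(* [nx x] is some exponent with [x - g *~ nx x] in [K]; by [phiE], compatibility of [c] makes the
   value the same for every such exponent. *)
pose nx x := xget 0 [set n : int | x - g *~ n \in K]%classic.
pose phi' x := phi (x - g *~ nx x) * c ^ nx x.
have phiE x n : x - g *~ n \in K -> phi' x = phi (x - g *~ n) * c ^ n.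
  move=> Kn; rewrite /phi'; have /(xgetPex 0) : exists n, x - g *~ n \in K by exists n.
  rewrite -/(nx x); move: (nx x) => m /= Km.
  have gmn : g *~ (m - n) = (x - g *~ n) - (x - g *~ m).
    by rewrite mulrzBr opprB [RHS]addrC addrA subrK.
  have Kmn : g *~ (m - n) \in K by rewrite gmn rpredB.
  have -> : x - g *~ n = x - g *~ m + g *~ (m - n) by rewrite gmn [RHS]addrC subrK.
  by rewrite (M _ _ Km Kmn) gc // -mulrA -expfzDr // subrK.
exists phi'; split=> //.
- split=> [x /adjoinP[n xn]|x y /adjoinP[m xm] /adjoinP[n yn]].
    by rewrite (phiE x n) // mulf_neq0 ?nz // expfz_neq0.
  have E : x + y - g *~ (m + n) = (x - g *~ m) + (y - g *~ n).
    by rewrite mulrzDr opprD addrACA.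
  rewrite (phiE x m) // (phiE y n) // (phiE _ (m + n)) E; last exact: rpredD.
  by rewrite (M _ _ xm yn) expfzDr // mulrACA.
- by move=> x Kx; rewrite (phiE x 0) ?subr0 // mulr1.
- by rewrite (phiE g 1) ?subrr ?rpred0 // (partial_char0 cphi) mul1r.
Qed.

(** The nonzero complex numbers form a divisible, hence injective, group; as [L] has finitely many
    generators, adjoining them in turn takes the place of Zorn's lemma. *)
Lemma partial_char_extend K phi : fin_gen L -> partial_char K phi ->
  exists t : torus R L, {in K, t =1 phi}.
Proof.
move=> [n [g gen]] cphi.
suff [K' [phi' [cphi' KK' phiE gK']]] : exists (K' : zmodClosed L) (phi' : L -> C),
    [/\ partial_char K' phi', {subset K <= K'}, {in K, phi' =1 phi} &
        {subset codom g <= K'}].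
  have KT l : l \in K'.
    have [a ->] := gen l; apply: rpred_sum => i _; apply: rpredMz.
    by apply: gK'; exact: codom_f.
  have [nz M] := cphi'.
  by exists (Torus (fun l => nz l (KT l)) (fun x y => M x y (KT x) (KT y))).
elim: (codom g) => [|h s [K1 [phi1 [c1 KK1 E1 sK1]]]]; first by exists K, phi; split.
have [c c0 hc] := partial_char_value h c1.
have [phi2 [c2 E2 _]] := partial_char_extend1 c1 c0 hc.
exists (adjoin K1 h : zmodClosed L), phi2; split=> // x.
- by move=> Kx; apply: sub_adjoin; exact: KK1.
- by move=> Kx; rewrite E2 ?KK1 ?E1.
- by rewrite inE => /predU1P[->|/sK1 xK1]; [exact: mem_adjoin|exact: sub_adjoin].
Qed.

Lemma char_with_value K (l : L) (c : C) : fin_gen L -> c != 0 ->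
  (forall n : int, l *~ n \in K -> c ^ n = 1) ->
  exists t : torus R L, t l = c /\ {in K, forall x, t x = 1}.
Proof.
move=> Lfg c0 lc.
have c1 : partial_char K (fun=> 1).
  by split=> [x _|x y _ _]; rewrite ?oner_neq0 ?mulr1.
have [|phi [c2 E phil]] := @partial_char_extend1 K _ l c c1 c0.
  by move=> n /lc.
have [t tE] := partial_char_extend Lfg c2.
exists t; split=> [|x Kx]; first by rewrite (tE _ (mem_adjoin K l)).
by rewrite (tE _ (sub_adjoin _ Kx)) E.
Qed.

Definition trivial_subgroup : {pred L} := pred1 0.

Lemma trivial_subgroup_closed : zmod_closed trivial_subgroup.
Proof.
split=> [|x y]; first exact: eqxx.
by move=> /eqP-> /eqP->; rewrite subr0; exact: eqxx.
Qed.

HB.instance Definition _ :=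
  GRing.isZmodClosed.Build L trivial_subgroup trivial_subgroup_closed.

Lemma torus_separates (l m : L) :
  fin_gen L -> (forall t : torus R L, t l = t m) -> l = m.
Proof.
move=> Lfg tlm; apply/eqP; rewrite -subr_eq0; apply/negP => /negP.
set x := l - m => x0.
have tx (t : torus R L) : t x = 1.
  by rewrite torusD torusN tlm mulfV ?torus_neq0.
have [d Kd] := multiples_dvdz trivial_subgroup x.
(* [d] is the order of [x], or 0 if it is infinite. In the infinite case 2 serves, and order 1 would
   force [x] to vanish. *)
have [c c1 cd] : exists2 c : C, c != 1 & c != 0 /\ c ^+ d = 1.
  case: d Kd => [|[|d]] Kd.
  - by exists 2; rewrite ?(eqr_nat C 2 1) // (pnatr_eq0 C 2).
  - by have := Kd 1; rewrite unfold_in mulr1z /= (negPf x0) dvd1z.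
  have [c c1 cd] := @nontrivial_root_of_unity d.+2 isT.
  exists c => //; split=> //.
  by apply: contra_eq_neq cd => ->; rewrite expr0n eq_sym oner_eq0.
have [c0 cd1] := cd.
have [n|t [tx' _]] := @char_with_value trivial_subgroup x c Lfg c0.
  by rewrite Kd => /dvdzP[q ->]; rewrite mulrC -exprz_exp -exprnP cd1 exp1rz.
by move: c1; rewrite -tx' tx eqxx.
Qed.

End CharacterExtension.

(** * Additive maps and the duality of tori *)

Lemma additive_of_morphism (A B : zmodType) (h : A -> B) :
  {morph h : x y / x - y} -> exists i : {additive A -> B}, i =1 h.
Proof.
move=> hB.
pose i : {additive A -> B} := HB.pack h (GRing.isZmodMorphism.Build A B h hB).
by exists i.
Qed.

Section Image.
Variables (A B : zmodType) (i : {additive A -> B}).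

Definition additive_image : {pred B} := fun b => `[< exists a, b = i a >].

Lemma additive_imageP b : reflect (exists a, b = i a) (b \in additive_image).
Proof. exact: asboolP. Qed.

Lemma additive_image_closed : zmod_closed additive_image.
Proof.
split=> [|x y /additive_imageP[a ->] /additive_imageP[b ->]]; apply/additive_imageP.
  by exists 0; rewrite raddf0.
by exists (a - b); rewrite raddfB.
Qed.

HB.instance Definition _ :=
  GRing.isZmodClosed.Build B additive_image additive_image_closed.

End Image.

(** The product of exponents that bring the generators into [K] works for all elements. *)
Lemma fin_gen_cofinite (L : zmodType) (K : zmodClosed L) :
  fin_gen L -> (forall l, exists2 n : nat, (0 < n)%N & l *+ n \in K) ->
  exists2 N : nat, (0 < N)%N & forall l, l *+ N \in K.
Proof.
move=> [n [g gen]] tors.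
pose m i := s2val (cid2 (tors (g i))).
have m0 i : (0 < m i)%N by exact: s2valP (cid2 (tors (g i))).
have mK i : g i *+ m i \in K by exact: s2valP' (cid2 (tors (g i))).
exists (\prod_i m i)%N => [|l]; first exact: prodn_gt0.
have [c ->] := gen l; rewrite -sumrMnl; apply: rpred_sum => i _.
rewrite pmulrn -mulrzA mulrC mulrzA rpredMz // -pmulrn (bigD1 i) //=.
by rewrite mulrnA rpredMn.
Qed.

Lemma free_fin_rank_gen (L : zmodType) : free_fin_rank L -> fin_gen L.
Proof.
move=> [n [f [g fK gK]]]; exists n, (fun i => g (delta_mx 0 i)) => l.
exists (fun i => f l 0 i); apply: (can_inj fK).
rewrite raddf_sum /=; apply/rowP => j; rewrite summxE (bigD1 j) //=.
rewrite big1 => [|i ij]; rewrite raddfMz gK -scaler_int !mxE ?eqxx /=.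
  by rewrite mulr1 addr0 intz.
by rewrite eq_sym (negPf ij) mulr0.
Qed.

Section Duality.
Variable R : realType.
Local Notation C := R[i].

(** The dual character is chosen separately for each [m]; the choice is additive because points of
    the torus separate characters. *)
Lemma algebraic_hom_additive_dual (L M : zmodType) (f : torus R L -> torus R M) :
  fin_gen L -> algebraic_hom f ->
  exists i : {additive M -> L}, forall t m, f t m = t (i m).
Proof.
move=> Lfg falg; have [h hE] := choice (algebraic_hom_dual falg).
have [m n|i iE] := @additive_of_morphism _ _ h.
  apply: (@torus_separates R) => // t.
  by rewrite !torusD !torusN -!hE torusD torusN.
by exists i => t m; rewrite iE hE.
Qed.

Lemma dual_map_algebraic (L M : zmodType) (i : {additive M -> L}) :
  algebraic_hom (@dual_map R L M i).
Proof.
split=> [s t|phi [n [c [l phiE]]]]; first exact: torus_ext.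
by exists n, c, (fun j => i (l j)) => t; rewrite /= phiE.
Qed.

(** Surjectivity of the covering map gives injectivity of [i]; finiteness of its kernel gives a
    cokernel of finite exponent. *)
Lemma covering_inclusion (Gam : zmodType) (X : torus_over R Gam) :
  fin_gen Gam -> covering X ->
  exists i : {additive Gam -> chars X},
    [/\ i =1 pull_char X, forall (t : torus R (chars X)) g, cov_map t g = t (i g),
        injective i
      & exists2 N : nat, (0 < N)%N & forall l, l *+ N \in additive_image i].
Proof.
move=> Gfg [Lfg falg fsurj kfin].
have [i iE] := algebraic_hom_additive_dual Lfg falg.
exists i; split=> //.
- move=> g; rewrite /pull_char.
  have ex : exists l, forall t : torus R (chars X), cov_map t g = t l by exists (i g).
  apply: (@torus_separates R) => // t.
  by have := xgetPex 0 ex t => <-; rewrite iE.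
- move=> g h gh; apply: (@torus_separates R) => // u.
  by have [t <-] := fsurj u; rewrite !iE gh.
apply: fin_gen_cofinite => // l; have [d ld] := multiples_dvdz (additive_image i) l.
have [d0|d0] := posnP d; last by exists d => //; have := ld d; rewrite dvdzz.
(* If no positive multiple of [l] lies in the image, elements of the kernel take arbitrary nonzero
   values at [l], and the kernel is infinite. *)
have val_l n : exists2 t : torus R (chars X), cov_map t = 1%g & t l = n.+1%:R.
  have [||t [tl t1]] := @char_with_value R _ (additive_image i) l n.+1%:R Lfg.
  - by rewrite pnatr_eq0.
  - by move=> m; rewrite ld d0 dvd0z => /eqP->.
  exists t => //; apply: torus_ext => g; rewrite iE t1 //.
  by apply/additive_imageP; exists g.
have : finite_set (range (fun n : nat => n.+1%:R : C)).
  apply: sub_finite_set (finite_image (fun t : torus R (chars X) => t l) kfin).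
  by move=> _ [n _ <-]; have [t t1 tn] := val_l n; exists t.
rewrite (eq_finite_set (inj_card_eq _)); first by move=> /infinite_nat.
by move=> x y _ _ /eqP; rewrite eqr_nat => /eqP[].
Qed.

End Duality.

(** * Torsion and multiplicities *)

Lemma quot_piE (L : zmodType) (K : zmodClosed L) (x y : L) :
  (\pi_(Quotient.quot K) x == \pi_(Quotient.quot K) y)%qT = (x - y \in K).
Proof. by rewrite Quotient.idealrBE. Qed.

Lemma quot_pi_eq0 (L : zmodType) (K : zmodClosed L) (x : L) :
  (\pi_(Quotient.quot K) x == 0)%qT = (x \in K).
Proof. by rewrite -(raddf0 (\pi_(Quotient.quot K))%qT) quot_piE subr0. Qed.

Lemma fin_gen_quot (L : zmodType) (K : zmodClosed L) :
  fin_gen L -> fin_gen (Quotient.quot K).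
Proof.
move=> [n [g gen]]; exists n, (fun i => \pi_(Quotient.quot K) (g i))%qT => q.
have [c cE] := gen (generic_quotient.repr q); exists c.
rewrite -[LHS](reprK (q : Quotient.quot K)) cE raddf_sum.
by apply: eq_bigr => i _; rewrite raddfMz.
Qed.

(** If [g] has infinite order modulo [K], torsion elements of K + Zg already lie in [K]. Otherwise
    they fall into finitely many classes modulo [K]. *)
Lemma finite_torsion_adjoin (L : zmodType) (K : zmodClosed L) g :
  finite_set (@torsion L `&` [set` K])%classic ->
  finite_set (@torsion L `&` [set` adjoin K g])%classic.
Proof.
move=> fin; have [d gd] := multiples_dvdz K g.
have [d0|d0] := posnP d.
  apply: sub_finite_set fin => x /= [xt /adjoinP[n xn]]; split=> //=.
  have [m m0 xm] := xt.
  have : g *~ (n * m%:Z) \in K.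
    have -> : g *~ (n * m%:Z) = - ((x - g *~ n) *+ m).
      by rewrite mulrnBl xm sub0r opprK mulrzA pmulrn.
    by rewrite rpredN rpredMn.
  rewrite gd d0 dvd0z mulf_eq0 eqz_nat (gtn_eqF m0) orbF => /eqP n0.
  by rewrite n0 subr0 in xn.
(* The torsion elements in the coset of [g *~ j]: empty, or contained in a translate of the torsion
   of [K]. *)
pose T j := [set x | @torsion L x /\ x - g *~ j%:Z \in K]%classic.
have Tfin j : finite_set (T j).
  have [[x0 [x0t x0j]]|noT] := EM (exists x, T j x); last first.
    by apply: (sub_finite_set (B := set0)) => // x Tx; case: noT; exists x.
  apply: sub_finite_set (finite_image (fun y => x0 + y) fin) => x [xt xj].
  exists (x - x0); last by rewrite addrC subrK.
  split=> /=; last first.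
    have -> : x - x0 = (x - g *~ j) - (x0 - g *~ j) by rewrite opprB addrA subrK.
    by rewrite rpredB.
  have [m m0 xm] := xt; have [m' m'0 xm'] := x0t.
  exists (m * m')%N; first by rewrite muln_gt0 m0.
  by rewrite mulrnBl mulrnA xm mul0rn mulnC mulrnA xm' mul0rn subr0.
apply: sub_finite_set (bigcup_finite (finite_II d) (fun j _ => Tfin j)).
move=> x [xt /adjoinP[n xn]].
have := modz_ge0 n (_ : d%:Z != 0); rewrite eqz_nat gtn_eqF // => /(_ isT).
have : (n %% d)%Z < d by rewrite ltz_pmod.
case E : (n %% d)%Z => [k|//] kd _; exists k => //; split=> //.
have -> : x - g *~ k = x - g *~ n + g *~ (divz n d * d).
  by rewrite -E /modz mulrzBr opprB addrA addrAC.
by rewrite rpredD // gd dvdz_mull.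
Qed.

Lemma finite_torsion (L : zmodType) : fin_gen L -> finite_set (@torsion L).
Proof.
move=> [n [g gen]].
suff [K [gK Kfin]] : exists K : zmodClosed L,
    {subset codom g <= K} /\ finite_set (@torsion L `&` [set` K])%classic.
  apply: sub_finite_set Kfin => x xt; split=> //=.
  have [c ->] := gen x; apply: rpred_sum => i _; apply: rpredMz.
  by apply: gK; exact: codom_f.
elim: (codom g) => [|h s [K [sK fin]]].
  exists (@trivial_subgroup L : zmodClosed L); split=> //.
  by apply: sub_finite_set (finite_set1 0) => x [_ /eqP].
exists (adjoin K h : zmodClosed L); split; last exact: finite_torsion_adjoin.
by move=> x; rewrite inE => /predU1P[->|/sK xK]; [exact: mem_adjoin|exact: sub_adjoin].
Qed.

Section Multiplicity.
Variables (E : finType).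

Lemma torsion_quotP (L : zmodType) (chi : E -> L) (S : {set E}) (l : L) :
  @torsion (quot_char_span chi S) (\pi_(Quotient.quot (char_span chi S)) l)%qT
  <-> l \in radical chi S.
Proof.
split=> [[k k0 lk]|/radicalP[k k0 lk]].
  apply/radicalP; exists k => //.
  by rewrite -quot_pi_eq0 raddfMn; apply/eqP.
by exists k => //; rewrite -raddfMn; apply/eqP; rewrite quot_pi_eq0.
Qed.

Variables (L M : zmodType) (i : {additive L -> M}).
Hypothesis i_inj : injective i.
Variables (chi : E -> L) (chi' : E -> M).
Hypothesis chi'E : forall e, chi' e = i (chi e).
Variable S : {set E}.

Lemma char_span_image m :
  m \in char_span chi' S <-> exists2 l, l \in char_span chi S & m = i l.
Proof.
split=> [/char_spanP[c ->]|[_ /char_spanP[c ->] ->]].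
  exists (\sum_(e in S) chi e *~ c e); first by apply/char_spanP; exists c.
  by rewrite raddf_sum; apply: eq_bigr => e _; rewrite raddfMz chi'E.
apply/char_spanP; exists c.
by rewrite raddf_sum; apply: eq_bigr => e _; rewrite raddfMz chi'E.
Qed.

Lemma char_span_inj l : (i l \in char_span chi' S) = (l \in char_span chi S).
Proof.
apply/idP/idP => [/char_span_image[m Km /i_inj->]//|Kl].
by apply/char_span_image; exists l.
Qed.

Lemma radical_inj l : (i l \in radical chi' S) = (l \in radical chi S).
Proof.
by apply/radicalP/radicalP => -[k k0 kl]; exists k => //; move: kl;
  rewrite -raddfMn char_span_inj.
Qed.

Variables (G : finZmodType) (p : {additive M -> G}).
Hypothesis p_surj : forall g, exists m, p m = g.
Hypothesis p_ker : forall m, p m = 0 <-> exists l, m = i l.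

(** This is H_S: the part of the cokernel [G] hit by the radical of Gam_S taken in the larger group
    [M]. *)
Definition radical_image : {set G} :=
  [set g | `[< exists2 m, m \in radical chi' S & p m = g >]].

Lemma radical_imageP g :
  reflect (exists2 m, m \in radical chi' S & p m = g) (g \in radical_image).
Proof. by rewrite inE; exact: asboolP. Qed.

Lemma radical_image_group_set : group_set radical_image.
Proof.
apply/group_setP; split=> [|g h /radical_imageP[m mr <-] /radical_imageP[n nr <-]].
  by apply/radical_imageP; exists 0; rewrite ?raddf0 ?rpred0.
by apply/radical_imageP; exists (m + n); rewrite ?raddfD ?rpredD.
Qed.

Canonical radical_image_group := Group radical_image_group_set.

(** Tor(M/Gam_S) is an extension of H_S by Tor(L/Gam_S); a set-theoretic section [s] of [p]
    identifies it with the product of the two sets. *)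
Lemma card_torsion_quot : fin_gen L ->
  (#|` fset_set (@torsion (quot_char_span chi' S))| =
   #|` fset_set (@torsion (quot_char_span chi S))| * #|radical_image|)%N.
Proof.
move=> Lfg.
have tfin : finite_set (@torsion (quot_char_span chi S)).
  exact/finite_torsion/fin_gen_quot.
(* Over H_S the section takes its values in the radical, so that [F] sends pairs in [A] to torsion
   classes. *)
have /choice[s sE] g : exists m, p m = g /\ (g \in radical_image -> m \in radical chi' S).
  have [/radical_imageP[m mr mg]|_] := boolP (g \in radical_image).
    by exists m.
  by have [m mg] := p_surj g; exists m.
pose F (u : quot_char_span chi S * G) : quot_char_span chi' S :=
  (\pi_(Quotient.quot (char_span chi' S)) (i (generic_quotient.repr u.1) + s u.2))%qT.
pose A := (@torsion (quot_char_span chi S) `*` [set` radical_image])%classic.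
have Afin : finite_set A by apply: finite_setX => //; exact: finite_finset.
have pi0 l : p (i l) = 0 by apply/p_ker; exists l.
have Finj : injective F.
  move=> [q g] [q' g'] /eqP; rewrite quot_piE opprD addrACA -raddfB => qg.
  have gg' : g = g'.
    have [m _ /(congr1 p)] := (char_span_image _).1 qg.
    rewrite [p (i _ + _)]raddfD !pi0 add0r raddfB !(proj1 (sE _)) => /eqP.
    by rewrite subr_eq0 => /eqP.
  move: qg; rewrite gg' subrr addr0 char_span_inj -quot_piE => /eqP.
  by rewrite !reprK /= => ->.
have FA : (F @` A = @torsion (quot_char_span chi' S))%classic.
  apply/seteqP; split=> [_ [[q g] [/= qt gr] <-]|q qt].
    apply/torsion_quotP; rewrite rpredD ?(proj2 (sE g)) // radical_inj.
    by apply/torsion_quotP; rewrite reprK.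
  have := reprK (q : Quotient.quot (char_span chi' S)).
  move: (generic_quotient.repr _) => m mq; rewrite -mq in qt *.
  move/torsion_quotP : qt => mr.
  have pmr : p m \in radical_image by apply/radical_imageP; exists m.
  have [l lE] : exists l, m - s (p m) = i l.
    by apply/p_ker; rewrite raddfB (proj1 (sE _)) subrr.
  have lr : l \in radical chi S by rewrite -radical_inj -lE rpredB // (proj2 (sE _)).
  exists ((\pi_(Quotient.quot (char_span chi S)) l)%qT, p m).
    by split=> //=; apply/torsion_quotP.
  apply/eqP; rewrite quot_piE /= -[X in _ - X](subrK (s (p m))) lE.
  rewrite opprD addrACA subrr addr0 -raddfB char_span_inj -quot_piE.
  by rewrite reprK.
pose X := fset_set (@torsion (quot_char_span chi S)).
(* [F] on a finite type: the quotient itself may be infinite, so its torsion classes are passed to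
   the type of elements of [X]. *)
pose F' (u : X * G) := F (val u.1, u.2).
have F'inj : injective F'.
  by move=> [q g] [q' g'] /Finj[] /val_inj-> ->.
have -> : fset_set (@torsion (quot_char_span chi' S)) =
    [fset F' u | u in finset.setX [set: X]%SET radical_image]%fset.
  rewrite -FA; apply/fsetP => y; rewrite in_fset_set; last exact: finite_image.
  apply/idP/imfsetP => /=.
    rewrite inE => -[[q g] [qt gr] <-].
    have qX : q \in X by rewrite in_fset_set // inE.
    by exists ([` qX]%fset, g); rewrite // finset.in_setX finset.in_setT.
  move=> [[q g]]; rewrite finset.in_setX finset.in_setT inE /= => gr ->.
  exists (val q, g) => //; split=> //=.
  by have := valP q; rewrite in_fset_set // inE.
by rewrite card_imfset //= -cardE finset.cardsX finset.cardsT -cardfE.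
Qed.

End Multiplicity.

(** * Restricted extension classes and coherence *)

Lemma Ext1_class_eq0 (G : finZmodType) (A : zmodType) (f : cocycle G A) :
  reflect (exists h : G -> A, forall a b, f (a, b) = h a + h b - h (a + b))
          (Ext1_class f == 0).
Proof.
have -> : 0 = Ext1_class (0 : cocycle G A) by rewrite /Ext1_class raddf0.
by apply: (iffP (Ext1_classP f 0)) => -[h hE]; exists h => a b;
  have := hE a b; rewrite !ffunE subr0.
Qed.

Lemma finZmod_mulrn_card (G : finZmodType) (a : G) : a *+ #|G| = 0.
Proof. by rewrite -FinRing.zmodXgE -finset.cardsT expg_cardG ?finset.in_setT. Qed.

Section ExtensionTheory.
Variables (G : finZmodType) (A : zmodType) (f : cocycle G A).
Local Notation ext := (extension f).

Lemma extensionD (s t : ext) :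
  s + t = (s.1 + t.1 + f (s.2, t.2), s.2 + t.2) :> ext.
Proof. by []. Qed.

Lemma cocycle0l a : f (0, a) = 0.
Proof. by have /is_cocycleP[/(_ a)] := valP f. Qed.

Lemma cocycleC a b : f (a, b) = f (b, a).
Proof. by have /is_cocycleP[_ /(_ a b)] := valP f. Qed.

Lemma extension_decomp (c : A) (a : G) :
  ((c, a) : ext) = extension_incl f c + ((0, a) : ext).
Proof. by rewrite extensionD /= cocycle0l !addr0 add0r. Qed.

(** The defect of a section from additivity: the cocycle, changed by the coboundary of the first
    coordinates. *)
Lemma extension_sectionB (c c' c'' : A) (a b : G) :
  ((c, a) : ext) + ((c', b) : ext) - ((c'', a + b) : ext) =
  extension_incl f (c + c' + f (a, b) - c'').
Proof.
apply/eqP; rewrite subr_eq; apply/eqP.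
by rewrite !extensionD /= cocycle0l addr0 add0r subrK.
Qed.

Lemma extension_proj_surj g : exists s : ext, extension_proj s = g.
Proof. by have [_ /(_ g)] := extension_exact f. Qed.

Lemma extension_proj_ker (s : ext) :
  extension_proj s = 0 <-> exists c, s = extension_incl f c.
Proof. by have [_ _ /(_ s)] := extension_exact f. Qed.

Lemma extension_incl_inj : injective (extension_incl f).
Proof. by have [] := extension_exact f. Qed.

End ExtensionTheory.

Section Splitting.
Variables (R : realType) (G : finZmodType) (Gam : zmodType) (E : finType).
Variables (D : arrangement R Gam E) (x : Ext1 G Gam) (S : {set E}).
Local Notation f := (Ext1_repr x).
Local Notation chi := (charac D).
Local Notation chi' := (fun e => extension_incl f (chi e)).

Lemma splits_onE (H : {group G}) :
  reflect (exists h : subgroup H -> quot_radical chi S, forall a b,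
     proj_radical chi S (f (val a, val b)) = h a + h b - h (a + b))
   (splits_on D x S H).
Proof.
rewrite /splits_on /Ext1_restr /Ext1_push Ext1_pull_class.
by apply: (iffP (Ext1_class_eq0 _)) => -[h hE]; exists h => a b;
  have := hE a b; rewrite !ffunE.
Qed.

Lemma radical_radical (L : zmodType) (psi : E -> L) (l : L) k :
  (0 < k)%N -> l *+ k \in radical psi S -> l \in radical psi S.
Proof.
move=> k0 /radicalP[m m0 lm]; apply/radicalP; exists (k * m)%N.
  by rewrite muln_gt0 k0.
by rewrite mulrnA.
Qed.

Lemma splits_on_sub (H : {group G}) :
  splits_on D x S H =
  (H \subset radical_image chi' S (@extension_proj G Gam f)).
Proof.
have rad_incl := radical_inj (@extension_incl_inj _ _ f) (fun e => erefl (chi' e)) S.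
apply/splits_onE/fintype.subsetP => [[h hE] a aH|sub].
  have /choice[c cE] b : exists c, proj_radical chi S c = - h b.
    by exists (generic_quotient.repr (- h b : Quotient.quot _)); rewrite [LHS]reprK.
  (* A section over [H] whose first coordinates lift [- h], so that its defect from additivity falls
     into the radical. *)
  pose s (b : subgroup H) : extension f := (c b, val b).
  have sD b b' : s b + s b' - s (b + b') \in radical chi' S.
    rewrite extension_sectionB rad_incl -quot_pi_eq0 -/(proj_radical chi S _).
    apply/eqP; rewrite !(raddfB, raddfD) /= !cE hE.
    by rewrite opprK -opprD addKr addNr.
  have sMn b n : s b *+ n - s (b *+ n) \in radical chi' S.
    elim: n => [|n IHn].
      by rewrite !mulr0n sub0r rpredN; have := sD 0 0; rewrite addr0 addrK.
    rewrite !mulrS.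
    have -> : s b + s b *+ n - s (b + b *+ n) =
       (s b *+ n - s (b *+ n)) + (s b + s (b *+ n) - s (b + b *+ n)).
      rewrite [RHS]addrA; congr (_ - _).
      by rewrite [in RHS](addrC (s b)) addrA subrK addrC.
    by rewrite rpredD.
  pose b : subgroup H := Subgroup aH.
  apply/radical_imageP; exists (s b) => //.
  (* Modulo the radical, |H| times [s b] is the section at |H| times [b], which is 0; the radical is
     closed under division, hence contains [s b]. *)
  apply: (@radical_radical _ _ _ #|subgroup H|).
    by apply/card_gt0P; exists b.
  have := sMn b #|subgroup H|; rewrite finZmod_mulrn_card.
  have s0 : s 0 \in radical chi' S by have := sD 0 0; rewrite addr0 addrK.
  by move=> /rpredD/(_ s0); rewrite subrK.
have /choice[c cE] (a : subgroup H) : exists c : Gam,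
    ((c, val a) : extension f) \in radical chi' S.
  have /radical_imageP[[c b] cr /= <-] := sub _ (valP a).
  by exists c.
(* Conversely, lifts chosen inside the radical have their defect there; the negated first
   coordinates split the cocycle. *)
exists (fun a => - proj_radical chi S (c a)) => a b.
have := rpredB (rpredD (cE a) (cE b)) (cE (a + b)).
rewrite extension_sectionB rad_incl -quot_pi_eq0 -/(proj_radical chi S _).
rewrite !(raddfB, raddfD) /= subr_eq0 => /eqP <-.
by rewrite opprK -opprD addKr.
Qed.

End Splitting.

Lemma fin_gen_finType (L : zmodType) (I : finType) (g : I -> L) :
  (forall l, exists c : I -> int, l = \sum_i g i *~ c i) -> fin_gen L.
Proof.
move=> gen; exists #|I|, (fun j => g (enum_val j)) => l.
have [c ->] := gen l; exists (fun j => c (enum_val j)).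
by rewrite (reindex (fun j : 'I_#|I| => enum_val j)) //; exact/onW_bij/enum_val_bij.
Qed.

Section ExtensionCovering.
Variables (R : realType) (G : finZmodType) (Gam : zmodType).
Hypothesis Gam_fg : fin_gen Gam.
Local Notation C := R[i].

Lemma fin_gen_extension (f : cocycle G Gam) : fin_gen (extension f).
Proof.
have [n [g gen]] := Gam_fg.
apply: (@fin_gen_finType _ ('I_n + G)%type (fun u => match u with
  inl j => extension_incl f (g j) | inr a => ((0, a) : extension f) end)).
move=> [c a]; have [k kE] := gen c.
exists (fun u => match u with inl j => k j | inr b => (b == a)%:Z end).
rewrite big_sumType /= extension_decomp; congr (_ + _).
  rewrite kE raddf_sum /=; apply: eq_bigr => j _.
  exact: (raddfMz (extension_incl f)).
rewrite (bigD1 a) //= eqxx mulr1z big1 ?addr0 // => b /negPf->.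
by rewrite mulr0z.
Qed.

(** A character trivial on [Gam] is determined by its values at the elements (0, a), which are
    |G|-th roots of unity; [phi] records their positions in the list [r] of these roots. *)
Lemma finite_kernel (f : cocycle G Gam) :
  finite_set [set t : torus R (extension f) |
                forall c, t (extension_incl f c) = 1]%classic.
Proof.
set K := (X in finite_set X).
have N0 : (0 < #|G|)%N by apply/card_gt0P; exists 0.
have [r rE] := closed_field_poly_normal ('X^#|G| - 1%:P : {poly C}).
have tr t a : K t -> t ((0, a) : extension f) \in r.
  move=> Kt; have [c cE] : exists c, ((0, a) : extension f) *+ #|G| = extension_incl f c.
    apply/extension_proj_ker; rewrite raddfMn; exact: finZmod_mulrn_card.
  have : root ('X^#|G| - 1%:P) (t ((0, a) : extension f)).
    by rewrite /root !hornerE -torusMn cE Kt subrr.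
  rewrite rE rootZ ?root_prod_XsubC //.
  by rewrite lead_coef_eq0 -size_poly_eq0 size_XnsubC.
pose phi (t : torus R (extension f)) : {ffun G -> 'I_(size r).+1} :=
  [ffun a => inord (index (t ((0, a) : extension f)) r)].
rewrite -(@eq_finite_set _ _ (phi @` K)%classic K); first exact: finite_finset.
apply: inj_card_eq => s t; rewrite !inE => Ks Kt /ffunP st.
apply: torus_ext => -[c a]; rewrite extension_decomp !torusD Ks Kt.
have := st a; rewrite !ffunE => /(congr1 (@nat_of_ord _)).
rewrite !inordK ?ltnS ?index_size // => /(congr1 (nth 0 r)).
by rewrite !nth_index ?tr // => ->.
Qed.

Lemma extension_torus_covering (x : Ext1 G Gam) : covering (extension_torus R x).
Proof.
split; first exact: fin_gen_extension.
- exact: dual_map_algebraic.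
- move=> u.
  pose K := additive_image (@extension_incl G Gam (Ext1_repr x)).
  (* Reading [u] off the first coordinate gives a character only on the copy of [Gam], which is then
     extended to the whole group. *)
  pose phi (s : extension (Ext1_repr x)) := u s.1.
  have cphi : partial_char (K : zmodClosed (extension (Ext1_repr x))) phi.
    split=> [s _|_ _ /additive_imageP[c ->] /additive_imageP[d ->]].
      exact: torus_neq0.
    by rewrite /phi -raddfD /= torusD.
  have [t tE] := partial_char_extend (fin_gen_extension _) cphi.
  exists t; apply: torus_ext => c /=; rewrite tE //.
  by apply/additive_imageP; exists c.
apply: sub_finite_set (finite_kernel (Ext1_repr x)) => t /= t1 c.
by have := congr1 (fun u : torus R Gam => u c) t1.
Qed.

Lemma extension_torus_pull_char (x : Ext1 G Gam) :
  pull_char (extension_torus R x) =1 extension_incl (Ext1_repr x).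
Proof.
have [i [iE iT _ _]] := covering_inclusion Gam_fg (extension_torus_covering x).
move=> c; rewrite -iE; apply: (@torus_separates R).
  exact: fin_gen_extension.
by move=> t; rewrite -iT.
Qed.

Variables (E : finType) (D : arrangement R Gam E).

Lemma multiplicity_gt0 S : (0 < multiplicity D S)%N.
Proof.
have fin : finite_set (@torsion (quot_char_span (charac D) S)).
  exact/finite_torsion/fin_gen_quot.
rewrite cardfs_gt0; apply/fset0Pn; exists 0.
by rewrite in_fset_set // inE; exists 1%N.
Qed.

Lemma multiplicity_extension (x : Ext1 G Gam) S :
  multiplicity (lift_arrangement D (extension_torus R x)) S =
  (multiplicity D S * #|radical_image
     (fun e => extension_incl (Ext1_repr x) (charac D e)) S
     (@extension_proj G Gam (Ext1_repr x))|)%N.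
Proof.
rewrite -(card_torsion_quot (@extension_incl_inj _ _ (Ext1_repr x)) (fun=> erefl)
  S (@extension_proj_surj _ _ _) (@extension_proj_ker _ _ _) Gam_fg) /multiplicity /=.
by under [in LHS]eq_fun => e do rewrite extension_torus_pull_char.
Qed.

(** [Hx S] contains every subgroup on which pi_S x splits, so it is H_S(x). Multiplying by the
    nonzero m_U(S), coherence becomes m_T(S) = m_U(S) |H_S(x)|, and the right-hand side is the
    multiplicity upstairs. *)
Lemma coherentE (mT : {set E} -> nat) (x : Ext1 G Gam) :
  coherent D mT x <->
  multiplicity (lift_arrangement D (extension_torus R x)) =1 mT.
Proof.
set Hx := fun S => radical_image_group
     (fun e => extension_incl (Ext1_repr x) (charac D e)) S
     (@extension_proj G Gam (Ext1_repr x)).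
have isH S : is_H D x S (Hx S).
  split=> [|K].
    apply/maxgroupP; rewrite splits_on_sub; split=> // K; rewrite splits_on_sub => KH HK.
    by apply/eqP; rewrite finset.eqEsubset KH.
  move=> /maxgroupP[]; rewrite splits_on_sub => KH Kmax; apply/val_inj => /=.
  by rewrite -(Kmax (Hx S)) // splits_on_sub.
have m0 S : (multiplicity D S)%:R != 0 :> rat.
  by rewrite pnatr_eq0 -lt0n multiplicity_gt0.
split=> [coh S|mE S].
  have [H [_ /(_ _ (isH S).1) HE]] := coh S; rewrite -{}HE multiplicity_extension => cH.
  apply/eqP; rewrite -(eqr_nat rat) natrM; apply/eqP.
  by rewrite [X in _ * X]cH mulrC divfK.
exists (Hx S); first exact: isH.
by rewrite -mE multiplicity_extension natrM mulrC mulKf.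
Qed.

End ExtensionCovering.

(** * Isomorphisms over the base torus *)

Section IsoOver.
Variables (R : realType) (Gam : zmodType).
Implicit Types X Y Z : torus_over R Gam.

Lemma algebraic_hom_comp (A B C : zmodType) (f : torus R A -> torus R B)
    (g : torus R B -> torus R C) :
  algebraic_hom f -> algebraic_hom g -> algebraic_hom (g \o f).
Proof.
move=> [fM freg] [gM greg]; split=> [s t|phi /greg/freg //].
by rewrite /= fM gM.
Qed.

Lemma iso_over_refl X : iso_over X X.
Proof. by exists id, id; split. Qed.

Lemma iso_over_sym X Y : iso_over X Y -> iso_over Y X.
Proof.
move=> [f [g [falg galg fK gK cov]]]; exists g, f; split=> // t.
by rewrite -cov gK.
Qed.

Lemma iso_over_trans X Y Z : iso_over X Y -> iso_over Y Z -> iso_over X Z.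
Proof.
move=> [f [g [falg galg fK gK cov]]] [f' [g' [falg' galg' fK' gK' cov']]].
exists (f' \o f), (g \o g'); split.
- exact: algebraic_hom_comp.
- exact: algebraic_hom_comp.
- exact: can_comp.
- exact: can_comp.
- by move=> t; rewrite /= cov' cov.
Qed.

Lemma additive_inverse (A B : zmodType) (f : {additive A -> B}) :
  bijective f -> exists g : {additive B -> A}, cancel f g /\ cancel g f.
Proof.
move=> [g fK gK]; have [x y|h hE] := @additive_of_morphism _ _ g.
  by apply: (can_inj fK); rewrite raddfB !gK.
by exists h; split=> x; rewrite hE.
Qed.

Lemma iso_over_additive X Y (f : {additive chars Y -> chars X}) :
  bijective f ->
  (forall t g, cov_map (t := Y) (dual_map f t) g = cov_map t g) -> iso_over X Y.
Proof.
move=> /additive_inverse[g [fK gK]] cov.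
exists (dual_map f), (dual_map g); split.
- exact: dual_map_algebraic.
- exact: dual_map_algebraic.
- by move=> t; apply: torus_ext => l /=; rewrite gK.
- by move=> t; apply: torus_ext => l /=; rewrite fK.
- by move=> t; apply: torus_ext => c; rewrite cov.
Qed.

Lemma iso_over_dual X Y :
  fin_gen (chars X) -> fin_gen (chars Y) -> iso_over X Y ->
  exists f : {additive chars Y -> chars X},
    bijective f /\ forall t g, cov_map (t := Y) (dual_map f t) g = cov_map t g.
Proof.
move=> Xfg Yfg [f [g [falg galg fK gK cov]]].
have [f' f'E] := algebraic_hom_additive_dual Xfg falg.
have [g' g'E] := algebraic_hom_additive_dual Yfg galg.
exists f'; split.
  exists g' => m; apply: (@torus_separates R) => // t.
    by rewrite -g'E -f'E gK.
  by rewrite -f'E -g'E fK.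
move=> t c; rewrite -cov; congr (cov_map _ c).
by apply: torus_ext => m /=; rewrite f'E.
Qed.

End IsoOver.

(** * Morphisms of extensions and orbits of classes *)

Section ExtensionMorphism.
Variables (G : finZmodType) (A L : zmodType) (f : cocycle G A).
Variables (i : {additive A -> L}) (s : G -> L).
Hypothesis sD : forall a b, s a + s b = s (a + b) + i (f (a, b)).

(** The defect of [s] is the image of the cocycle, so (c, g) -> i c + s g respects the twisted
    addition; normalization of the cocycle forces s 0 = 0. *)
Lemma extension_morphism :
  exists h : {additive extension f -> L},
    (forall c g, h (c, g) = i c + s g) /\
    forall c, h (extension_incl f c) = i c.
Proof.
have s0 : s 0 = 0.
  have := sD 0 0; rewrite addr0 cocycle0l raddf0 => /(congr1 (fun y => y - s 0)).
  by rewrite addrK addr0 subrr.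
pose h0 (u : extension f) := i u.1 + s u.2.
have [u v|h hE] := @additive_of_morphism _ _ h0.
  apply: (canRL (addrK _)); rewrite -{2}(subrK v u); move: (u - v) => {}u.
  by rewrite /h0 extensionD /= !raddfD /= addrACA sD [s _ + _]addrC !addrA.
exists h; split=> [c g|c]; rewrite hE /h0 //=.
by rewrite s0 addr0.
Qed.

End ExtensionMorphism.

(** A form of the five lemma. [p \o s] is allowed to be any bijection, so that maps covering a
    nontrivial automorphism of [G] are included. *)
Lemma extension_morphism_bij (G : finZmodType) (A L : zmodType) (f : cocycle G A)
    (i : {additive A -> L}) (s : G -> L) (p : {additive L -> G})
    (h : {additive extension f -> L}) :
  injective i -> (forall l, p l = 0 <-> exists c, l = i c) ->
  bijective (p \o s) -> (forall c g, h (c, g) = i c + s g) -> bijective h.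
Proof.
move=> i_inj p_ker [v psK vK] hE.
have pi0 c : p (i c) = 0 by apply/p_ker; exists c.
have h_inj : injective h.
  move=> [c g] [c' g']; rewrite !hE => E.
  have gg' : g = g'.
    have := congr1 p E; rewrite !raddfD !pi0 !add0r => psg.
    exact: (can_inj psK).
  by move: E; rewrite gg' => /addIr/i_inj->.
have h_surj l : exists u, h u = l.
  have [c cE] : exists c, l - s (v (p l)) = i c.
    by apply/p_ker; rewrite raddfB [p (s _)]vK subrr.
  by exists (c, v (p l)); rewrite hE -cE subrK.
have /choice[k kE] := h_surj.
by exists k => // u; apply: h_inj.
Qed.

Lemma same_orbit_iso_over (R : realType) (G : finZmodType) (Gam : zmodType)
    (x y : Ext1 G Gam) : fin_gen Gam ->
  same_orbit x y <-> iso_over (extension_torus R x) (extension_torus R y).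
Proof.
move=> Gfg; split=> [[u u_bij yE]|].
  have [h hE] : exists h : G -> Gam, forall a b,
      Ext1_repr y (a, b) - Ext1_repr x (u a, u b) = h a + h b - h (a + b).
    have : Ext1_class (Ext1_repr y) == Ext1_class (cocycle_pull u (Ext1_repr x)).
      by rewrite Ext1_reprK yE.
    by case/Ext1_classP => h hE; exists h => a b; rewrite -hE ffunE.
  (* The coboundary [h] and the automorphism [u] combine into (c, a) -> (c + h a, u a), up to the
     twist of the addition. *)
  have [a b|k [kE k_incl]] := @extension_morphism G Gam (extension (Ext1_repr x))
      (Ext1_repr y) (@extension_incl G Gam (Ext1_repr x)) (fun g => (h g, u g)).
    apply/eqP; rewrite [X in _ == X]addrC -subr_eq raddfD; apply/eqP.
    rewrite extension_sectionB.
    congr (extension_incl _ _); apply/eqP.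
    by rewrite addrAC -hE subrK.
  apply: (@iso_over_additive _ _ (extension_torus R x) (extension_torus R y) k).
    apply: (extension_morphism_bij (@extension_incl_inj _ _ _)
      (@extension_proj_ker _ _ _) _ kE).
    exact: u_bij.
  by move=> t c /=; rewrite k_incl.
have xfg := fin_gen_extension Gfg (Ext1_repr x).
have yfg := fin_gen_extension Gfg (Ext1_repr y).
move=> /(@iso_over_dual _ _ (extension_torus R x) (extension_torus R y) xfg yfg).
move=> [f [f_bij fcov]].
have f_incl c : f (extension_incl _ c) = extension_incl _ c.
  by apply: (@torus_separates R) => // t; exact: (fcov t c).
pose e (a : G) : extension (Ext1_repr y) := (0, a).
pose h a := (f (e a)).1.
have fD a b : f (e a) + f (e b) - f (e (a + b)) = extension_incl _ (Ext1_repr y (a, b)).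
  by rewrite -f_incl -raddfD -raddfB extension_sectionB addr0 add0r subr0.
(* [f] is the identity on [Gam], so the second coordinate of [f] on the section [e] is the induced
   endomorphism of [G]. *)
have uD : {morph (fun a => (f (e a)).2) : a b / a - b}.
  move=> a b; have := congr1 (@extension_proj _ _ _) (fD (a - b) b).
  by rewrite subrK => /eqP; rewrite subr_eq add0r => /eqP <-; rewrite addrK.
have [u uE] := additive_of_morphism uD.
have u_inj : injective u.
  move=> a b /eqP; rewrite -subr_eq0 -raddfB uE => /eqP/extension_proj_ker[c].
  rewrite -f_incl => /(bij_inj f_bij) /(congr1 (@extension_proj _ _ _)) /= /eqP.
  by rewrite subr_eq0 => /eqP.
exists u; first exact: injF_bij.
(* The first coordinate [h] of [f] on the section supplies the coboundary between [y] and the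
   pullback of [x]. *)
apply: etrans (esym (Ext1_reprK y)) _; apply/eqP/Ext1_classP; exists h => a b.
have fE c : f (e c) = (h c, u c) by rewrite uE; exact: surjective_pairing.
have := fD a b; rewrite !fE raddfD extension_sectionB => /extension_incl_inj <-.
by rewrite ffunE addrAC addrK.
Qed.

(** The class is that of the factor set of a section [s], with s 0 = 0 to make the factor set
    normalized. *)
Lemma extension_class_exists (G : finZmodType) (A L : zmodType)
    (i : {additive A -> L}) (p : {additive L -> G}) :
  injective i -> (forall g, exists l, p l = g) ->
  (forall l, p l = 0 <-> exists c, l = i c) ->
  exists (x : Ext1 G A) (h : {additive extension (Ext1_repr x) -> L}),
    bijective h /\ forall c, h (extension_incl _ c) = i c.
Proof.
move=> i_inj p_surj p_ker.
have pi0 c : p (i c) = 0 by apply/p_ker; exists c.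
have /choice[s sP] : forall g, exists l, p l = g /\ (g = 0 -> l = 0).
  move=> g; have [->|/eqP g0] := eqVneq g 0; first by exists 0; rewrite raddf0.
  by have [l lg] := p_surj g; exists l.
have sK g : p (s g) = g by have [] := sP g.
have s0 : s 0 = 0 by have [_ ->] := sP 0.
have /choice[k kE] : forall ab : G * G, exists c,
    s ab.1 + s ab.2 - s (ab.1 + ab.2) = i c.
  by move=> ab; apply/p_ker; rewrite raddfB raddfD !sK subrr.
have kP : [ffun ab => k ab] \in @is_cocycle G A.
  apply/is_cocycleP; split=> [a|a b|a b c]; rewrite !ffunE; apply: i_inj.
  - by rewrite -kE /= s0 !add0r subrr raddf0.
  - by rewrite -!kE /= [s b + _]addrC [b + _]addrC.
  rewrite !raddfD -!kE /= [s a + s (b + c)]addrC [LHS]addrA [RHS]addrA.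
  rewrite [_ - _ + (s (b + c) + _)]addrA [_ - _ + (s (a + b) + _)]addrA !subrK.
  by rewrite [a + (b + c)]addrA [s b + s c + _]addrC addrA.
pose x := Ext1_class (Cocycle kP).
have : Ext1_class (Cocycle kP) == Ext1_class (Ext1_repr x) by rewrite Ext1_reprK.
case/Ext1_classP => h hE.
(* The chosen representative of the class differs from the factor set by the coboundary of [h];
   correcting the section by [i (h g)] compensates. *)
have [a b|t [tE t_incl]] := @extension_morphism G A L (Ext1_repr x) i
    (fun g => s g - i (h g)).
  have := hE a b; rewrite /= ffunE => E.
  have {E}-> : Ext1_repr x (a, b) = k (a, b) - (h a + h b - h (a + b)).
    by rewrite -E opprB addrC subrK.
  rewrite raddfB -kE /= [i (_ - h (a + b))]raddfB [i (h a + h b)]raddfD.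
  rewrite [RHS]addrACA opprB addKr [_ + (_ - s (a + b))]addrC subrK.
  by rewrite addrACA opprD.
exists x, t; split=> //.
apply: (extension_morphism_bij (p := p) i_inj p_ker _ tE).
by exists id => g; rewrite /= raddfB pi0 subr0 sK.
Qed.

Lemma multiplicity_iso_over (R : realType) (Gam : zmodType) (E : finType)
    (D : arrangement R Gam E) (X Y : torus_over R Gam) :
  fin_gen Gam -> covering X -> covering Y -> iso_over X Y ->
  multiplicity (lift_arrangement D X) =1 multiplicity (lift_arrangement D Y).
Proof.
move=> Gfg Xcov Ycov XY S.
have [Xfg _ _ _] := Xcov; have [Yfg _ _ _] := Ycov.
have [i [iE iT _ _]] := covering_inclusion Gfg Xcov.
have [j [jE jT _ _]] := covering_inclusion Gfg Ycov.
have [f [f_bij fcov]] := iso_over_dual Xfg Yfg XY.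
have fj e : charac (lift_arrangement D X) e = f (charac (lift_arrangement D Y) e).
  rewrite /= -iE -jE; apply: (@torus_separates R) => // t.
  by rewrite -iT -fcov jT.
have [g _ gK] := f_bij.
rewrite /multiplicity.
(* The isomorphism [f] is treated as an inclusion with trivial cokernel ['I_1], so the factor |H_S|
   is 1. *)
rewrite (@card_torsion_quot E _ _ f (bij_inj f_bij) _ _ fj S 'I_1
  (\0 : {additive chars X -> 'I_1})) //.
- rewrite [X in (_ * X)%N](_ : _ = 1%N) ?muln1 //.
  apply/eqP; rewrite eqn_leq; apply/andP; split.
    by rewrite (leq_trans (max_card _)) // card_ord.
  by apply/card_gt0P; exists 0; exact: (group1 (radical_image_group _ _ _)).
- by move=> a; exists 0; rewrite [a]ord1.
- by move=> l; split=> // _; exists (g l).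
Qed.

(** * Minors and Smith normal form *)

Section Minors.

(** The [c] with this property are the divisors of the k-th determinantal divisor. Index maps are
    arbitrary: a repeated index only adds a zero minor. *)
Definition minors_dvd k (c : int) m n (A : 'M[int]_(m, n)) : Prop :=
  forall (f : 'I_k -> 'I_m) (g : 'I_k -> 'I_n), (c %| \det (mxsub f g A))%Z.

(* The easy half of Cauchy-Binet: expand by multilinearity in the rows. *)
Lemma det_mulmx_rows k m (A : 'M[int]_(k, m)) (B : 'M[int]_(m, k)) :
  \det (A *m B) =
  \sum_(f : {ffun 'I_k -> 'I_m}) (\prod_i A i (f i)) * \det (rowsub f B).
Proof.
rewrite /determinant.
under eq_bigr => s _.
  under eq_bigr => i _ do rewrite mxE.
  rewrite bigA_distr_bigA /= big_distrr /=.
  over.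
rewrite exchange_big /=; apply: eq_bigr => f _.
rewrite big_distrr /=; apply: eq_bigr => s _.
rewrite big_split /= mulrCA; congr (_ * (_ * _)).
by apply: eq_bigr => i _; rewrite mxE.
Qed.

Lemma minors_dvd_mull k c p m n (P : 'M[int]_(p, m)) (A : 'M[int]_(m, n)) :
  minors_dvd k c A -> minors_dvd k c (P *m A).
Proof.
move=> cA f g; have -> : mxsub f g (P *m A) = rowsub f P *m colsub g A.
  by apply/matrixP => i j; rewrite !mxE; apply: eq_bigr => l _; rewrite !mxE.
rewrite det_mulmx_rows; apply: rpred_sum => h _; apply: dvdz_mull.
have -> : rowsub h (colsub g A) = mxsub h g A by apply/matrixP => i j; rewrite !mxE.
exact: cA.
Qed.

Lemma minors_dvd_tr k c m n (A : 'M[int]_(m, n)) :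
  minors_dvd k c A -> minors_dvd k c A^T.
Proof.
move=> cA f g; rewrite -det_tr.
have -> : (mxsub f g A^T)^T = mxsub g f A by apply/matrixP => i j; rewrite !mxE.
exact: cA.
Qed.

Lemma minors_dvd_mulr k c m n q (A : 'M[int]_(m, n)) (Q : 'M[int]_(n, q)) :
  minors_dvd k c A -> minors_dvd k c (A *m Q).
Proof.
move=> /minors_dvd_tr/(minors_dvd_mull Q^T)/minors_dvd_tr.
by rewrite -trmx_mul trmxK.
Qed.

Lemma minors_dvd_equiv k c m n (P : 'M[int]_m) (A : 'M[int]_(m, n)) (Q : 'M[int]_n) :
  P \in unitmx -> Q \in unitmx ->
  minors_dvd k c (P *m A *m Q) <-> minors_dvd k c A.
Proof.
move=> Pu Qu; split=> [cA|cA]; last exact/minors_dvd_mulr/minors_dvd_mull.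
have -> : A = invmx P *m (P *m A *m Q) *m invmx Q.
  by rewrite -mulmxA mulmxK // mulKmx.
exact/minors_dvd_mulr/minors_dvd_mull.
Qed.

(** The shape in which [int_Smith_normal_form] presents its result; entries past the end of [d] are
    0. *)
Definition smith_mx m n (d : seq int) : 'M[int]_(m, n) :=
  \matrix_(i, j) (d`_i *+ (i == j :> nat)).

Lemma sorted_dvdz_nth (d : seq int) i j :
  sorted dvdz d -> (i <= j)%N -> (d`_i %| d`_j)%Z.
Proof.
move=> d_sorted ij; have [dj|jd] := leqP (size d) j.
  by rewrite [d`_j]nth_default ?dvdz0.
apply: (sorted_leq_nth dvdz_trans dvdzz) => //; rewrite inE //.
exact: leq_ltn_trans ij jd.
Qed.

Lemma prod_sorted_dvdz (d : seq int) k (f : 'I_k -> nat) :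
  sorted dvdz d -> injective f ->
  (\prod_(i < k) d`_i %| \prod_i d`_(f i))%Z.
Proof.
move=> d_sorted; elim: k f => [|k IHk] f f_inj; first by rewrite !big_ord0.
(* Pigeonhole: k+1 distinct values cannot all lie below k. This factor absorbs the last one on the
   left. *)
have [i0 fi0] : exists i0, (k <= f i0)%N.
  apply/existsP; apply: contraT; rewrite negb_exists => /forallP small.
  have f_lt i : (f i < k)%N by rewrite ltnNge small.
  have := leq_card (fun i => Ordinal (f_lt i)); rewrite !card_ord ltnn; apply.
  by move=> i j /(congr1 val) /f_inj.
rewrite [X in (X %| _)%Z]big_ord_recr [X in (_ %| X)%Z](bigD1_ord i0) //=.
rewrite [X in (X %| _)%Z]mulrC dvdz_mul ?sorted_dvdz_nth //.
by apply: (IHk (fun i => f (lift i0 i))) => i j /f_inj /lift_inj.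
Qed.

Lemma minors_dvd_smith k c m n (d : seq int) :
  sorted dvdz d -> (k <= m)%N -> (k <= n)%N ->
  minors_dvd k c (smith_mx m n d) <-> (c %| \prod_(i < k) d`_i)%Z.
Proof.
move=> d_sorted km kn; split=> [/(_ (widen_ord km) (widen_ord kn))|cd f g].
  have -> : mxsub (widen_ord km) (widen_ord kn) (smith_mx m n d) =
      diag_mx (\row_(i < k) d`_i).
    by apply/matrixP => i j; rewrite !mxE.
  by rewrite det_diag; under eq_bigr do rewrite mxE.
have [f_inj|] := boolP (injectiveb f); last first.
  case/injectivePn => i [j ij fij].
  by rewrite (determinant_alternate ij) ?dvdz0 // => l; rewrite !mxE fij.
apply: rpred_sum => s _; apply: dvdz_mull.
(* A Leibniz term vanishes unless each row index meets the same column index; it is then a product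
   of diagonal entries at distinct positions. *)
have [/forallP fg|] := boolP [forall i, f i == g (s i) :> nat]; last first.
  rewrite negb_forall => /existsP[i fg].
  by rewrite (bigD1 i) //= !mxE (negPf fg) mulr0n mul0r dvdz0.
under eq_bigr => i _ do rewrite !mxE fg mulr1n.
apply: dvdz_trans cd _; apply: prod_sorted_dvdz => // i j /val_inj.
exact: (injectiveP _ f_inj).
Qed.

Lemma smith_mulE m n d (w : 'rV[int]_m) (i : 'I_m) (j : 'I_n) :
  i = j :> nat -> (w *m smith_mx m n d) 0 j = w 0 i * d`_i.
Proof.
move=> ij; rewrite mxE (bigD1 i) //= big1 ?addr0 => [|l li]; rewrite mxE -ij.
  by rewrite eqxx.
by rewrite (inj_eq val_inj) (negPf li) mulr0.
Qed.

Lemma smith_mul0 m n d (w : 'rV[int]_m) (j : 'I_n) :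
  (m <= j)%N -> (w *m smith_mx m n d) 0 j = 0.
Proof.
move=> mj; rewrite mxE big1 // => i _; rewrite mxE.
by rewrite ltn_eqF ?mulr0 // (leq_trans (ltn_ord i)).
Qed.

Definition row_indep m n (A : 'M[int]_(m, n)) : Prop :=
  forall v : 'rV[int]_m, v *m A = 0 -> v = 0.

Lemma smith_indep m n (P : 'M[int]_m) d (Q : 'M[int]_n) : P \in unitmx ->
  row_indep (P *m smith_mx m n d *m Q) ->
  (m <= n)%N /\ forall i : 'I_m, d`_i != 0.
Proof.
move=> Pu ind.
have ind0 (w : 'rV[int]_m) : w *m smith_mx m n d = 0 -> w = 0.
  move=> w0; have := ind (w *m invmx P).
  rewrite !mulmxA mulmxKV // w0 mul0mx => /(_ erefl) /(congr1 (mulmx^~ P)).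
  by rewrite /= mulmxKV // mul0mx.
have nz i : (delta_mx 0 i : 'rV[int]_m) *m smith_mx m n d <> 0.
  by move/ind0/(congr1 (fun v : 'rV[int]_m => v 0 i)); rewrite !mxE !eqxx.
split=> [|i].
  rewrite leqNgt; apply/negP => nm; apply: (nz (Ordinal nm)); apply/rowP => j.
  rewrite !mxE big1 // => i _; rewrite !mxE eqxx /=.
  have [->|_] := eqVneq i; last by rewrite mul0r.
  by rewrite mul1r /= gtn_eqF.
apply/eqP => di; apply: (nz i); apply/rowP => j; rewrite mxE big1 ?mxE // => l _.
by rewrite !mxE eqxx /=; have [->|_] := eqVneq l; rewrite ?di ?mul0rn ?mulr0 ?mul0r.
Qed.

Lemma minors_dependent k n c (A : 'M[int]_(k, n)) :
  ~ row_indep A -> minors_dvd k c A.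
Proof.
move=> dep f g; have [f_inj|] := boolP (injectiveb f); last first.
  case/injectivePn => i [j ij fij].
  by rewrite (determinant_alternate ij) ?dvdz0 // => l; rewrite !mxE fij.
suff -> : \det (mxsub f g A) = 0 by rewrite dvdz0.
apply/eqP; apply: contra_notT dep => det0 v vA.
(* There are exactly [k] rows, so an injective row selection is a permutation; the adjugate then
   turns a relation into det * v = 0. *)
pose s := perm (injectiveP _ f_inj).
have vM : \row_i v 0 (f i) *m mxsub f g A = 0.
  apply/rowP => j; have /rowP/(_ (g j)) := vA; rewrite !mxE => vj.
  rewrite -[RHS]vj [RHS](reindex_inj (perm_inj (s := s))) /=; apply: eq_bigr => i _.
  by rewrite !mxE permE.
have : \row_i v 0 (f i) *m (mxsub f g A *m \adj (mxsub f g A)) = 0.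
  by rewrite mulmxA vM mul0mx.
rewrite mul_mx_adj mul_mx_scalar => /rowP v0; apply/rowP => i; rewrite mxE.
have := v0 ((s^-1)%g i); rewrite !mxE => /eqP; rewrite mulf_eq0 (negPf det0) /=.
by rewrite -[f _](permE (injectiveP _ f_inj)) -/s permKV => /eqP.
Qed.

End Minors.

(** * Lattices *)

Lemma additive_mx m n (h : {additive 'rV[int]_m -> 'rV[int]_n}) :
  exists B : 'M[int]_(m, n), forall v, h v = v *m B.
Proof.
exists (\matrix_i h (delta_mx 0 i)) => v.
rewrite {1}[v]row_sum_delta raddf_sum mulmx_sum_row; apply: eq_bigr => i _.
by rewrite rowK -[v 0 i]intz !scaler_int raddfMz.
Qed.

Section LatticeBasis.
Variables (Gam L : zmodType) (n : nat).
Variables (fG : {additive Gam -> 'rV[int]_n}) (i : {additive Gam -> L}).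
Hypotheses (fG_bij : bijective fG) (i_inj : injective i).

(** Multiplication by [N] embeds [L] in [Gam], hence in Z^n, as a sublattice containing N Z^n; the
    Smith form of its generators gives a basis with [n] elements. *)
Lemma lattice_basis N : fin_gen L -> (forall l : L, torsion l -> l = 0) ->
  (0 < N)%N -> (forall l, l *+ N \in additive_image i) ->
  exists psi : {additive L -> 'rV[int]_n}, bijective psi.
Proof.
move=> [q [g gen]] tf N0 NL.
have /choice[phi0 phi0E] : forall l, exists v, exists2 c, l *+ N = i c & fG c = v.
  by move=> l; have /additive_imageP[c cE] := NL l; exists (fG c), c.
have [l m|phi phiE] := additive_of_morphism (h := phi0).
  have [c cE <-] := phi0E l; have [c' cE' <-] := phi0E m.
  have [c'' cE'' <-] := phi0E (l - m); rewrite -raddfB; congr (fG _).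
  by apply: i_inj; rewrite raddfB -cE -cE' -cE'' mulrnBl.
have phi_inj : injective phi.
  move=> l m; rewrite !phiE; have [c cE <-] := phi0E l; have [c' cE' <-] := phi0E m.
  move=> /(bij_inj fG_bij) cc'; apply/eqP; rewrite -subr_eq0; apply/eqP/tf.
  by exists N => //; rewrite mulrnBl cE cE' cc' subrr.
have phi_i c : phi (i c) = fG c *+ N.
  rewrite phiE; have [c' cE' <-] := phi0E (i c).
  by rewrite -raddfMn; congr (fG _); apply: i_inj; rewrite -cE' raddfMn.
pose M : 'M[int]_(q, n) := \matrix_j phi (g j).
have phi_im v : (exists l, phi l = v) <-> exists w, v = w *m M.
  split=> [[l <-]|[w ->]].
    have [c ->] := gen l; exists (\row_j c j).
    rewrite raddf_sum mulmx_sum_row; apply: eq_bigr => j _.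
    by rewrite rowK mxE -[c j]intz scaler_int intz raddfMz.
  exists (\sum_j g j *~ w 0 j); rewrite raddf_sum mulmx_sum_row; apply: eq_bigr => j _.
  by rewrite rowK -[w 0 j in RHS]intz scaler_int raddfMz.
have [P Pu [Q Qu [d d_sorted ME]]] := int_Smith_normal_form M.
rewrite -/(smith_mx q n d) in ME.
have phi_im' w : exists l, phi l = w *m smith_mx q n d *m Q.
  by apply/phi_im; exists (w *m invmx P); rewrite ME !mulmxA mulmxKV.
have phi_im2 l : exists w, phi l = w *m smith_mx q n d *m Q.
  have [|w wE] := (phi_im (phi l)).1; first by exists l.
  by exists (w *m P); rewrite wE ME !mulmxA.
(* The image of [phi] contains N times the j-th row of [Q], so column j of the Smith form cannot
   vanish. *)
have dq (j : 'I_n) : (j < q)%N /\ d`_j != 0.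
  have [fG' _ fG'K] := fG_bij.
  have [w wE] := phi_im2 (i (fG' ((delta_mx 0 j : 'rV_n) *m Q))).
  rewrite phi_i fG'K in wE.
  have {}wE := congr1 (fun v => mulmxr (invmx Q) v 0 j) wE.
  rewrite raddfMn /= !mulmxK // mulmxnE mxE !eqxx in wE.
  have N0' : N%:Z != 0 by rewrite eqz_nat gtn_eqF.
  have [jq|qj] := ltnP j q; last first.
    by rewrite smith_mul0 // in wE; move: N0'; rewrite -[N%:Z]natz wE.
  split=> //; apply: contra_neq N0' => dj.
  by rewrite (@smith_mulE _ _ _ _ (Ordinal jq)) //= dj mulr0 in wE; rewrite -[LHS]natz wE.
(* The rows of [C] form a basis of the image of [phi]; coordinates in it define [psi]. *)
pose C := diag_mx (\row_(j < n) d`_j) *m Q.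
have C_inj (v w : 'rV_n) : v *m C = w *m C -> v = w.
  rewrite /C !mulmxA => /(congr1 (mulmx^~ (invmx Q))); rewrite /= !mulmxK // => vw.
  apply/rowP => j; have /rowP/(_ j) := vw.
  by rewrite !mul_mx_diag !mxE; apply: mulIf; have [] := dq j.
have phi_C l : exists w, phi l = w *m C.
  have [w wE] := phi_im2 l.
  exists (\row_j w 0 (Ordinal (proj1 (dq j)))); rewrite wE /C mulmxA; congr (_ *m _).
  apply/rowP => j; rewrite mul_mx_diag (@smith_mulE _ _ _ _ (Ordinal (proj1 (dq j)))) //.
  by rewrite !mxE.
have C_phi w : exists l, phi l = w *m C.
  have [l lE] := phi_im' (\row_(j < q) if insub (val j) is Some j' then w 0 j' else 0).
  exists l; rewrite lE /C mulmxA; congr (_ *m _).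
  apply/rowP => j; rewrite mul_mx_diag (@smith_mulE _ _ _ _ (Ordinal (proj1 (dq j)))) //.
  by rewrite !mxE /= valK.
have /choice[psi0 psi0E] := phi_C.
have [l m|psi psiE] := additive_of_morphism (h := psi0).
  by apply: C_inj; rewrite mulmxBl -!psi0E raddfB.
have /choice[psi' psi'E] := C_phi.
exists psi, psi' => [l|w].
  by apply: phi_inj; rewrite psi'E psiE -psi0E.
by apply: C_inj; rewrite psiE -psi0E psi'E.
Qed.

End LatticeBasis.

Section TorsionMinors.
Variables (E : finType) (L : zmodType) (chi : E -> L) (n : nat).
Variable (psi : {additive L -> 'rV[int]_n}).
Hypothesis psi_bij : bijective psi.
Variables (k : nat) (f : 'I_k -> E).
Local Notation A := (\matrix_(i < k) psi (chi (f i))).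
Hypothesis A_indep : row_indep A.

Lemma row_indep_inj : injective f.
Proof.
move=> a b fab; apply/eqP; apply: contraT => ab.
have /A_indep/(congr1 (fun v : 'rV[int]_k => v 0 a)) :
    (delta_mx 0 a - delta_mx 0 b : 'rV[int]_k) *m A = 0.
  by rewrite mulmxBl -!rowE !rowK fab subrr.
by rewrite !mxE !eqxx (negPf ab).
Qed.

Lemma char_span_rowsE l :
  l \in char_span chi (f @: 'I_k) <-> exists w, psi l = w *m A.
Proof.
have sumE (c : E -> int) : psi (\sum_(e in f @: 'I_k) chi e *~ c e) =
    (\row_i c (f i)) *m A.
  rewrite finset.big_imset /=; last by move=> a b _ _; exact: row_indep_inj.
  rewrite raddf_sum mulmx_sum_row; apply: eq_big => // a _.
  by rewrite rowK mxE -[c _ in RHS]intz scaler_int raddfMz.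
split=> [/char_spanP[c ->]|[w wE]]; first by rewrite sumE; eexists.
apply/char_spanP.
exists (fun e => if [pick a | f a == e] is Some a then w 0 a else 0).
apply: (bij_inj psi_bij); rewrite sumE wE; congr (_ *m _); apply/rowP => a.
rewrite mxE; case: pickP => [b /eqP/row_indep_inj->//|/(_ a)].
by rewrite eqxx.
Qed.

(** In a basis adapted to the Smith form of the characters, the torsion is the sum of the Z/d_a, and
    the product of the d_a is, up to sign, the gcd of the k-minors. *)
Lemma card_torsion_minors (c : int) :
  (c %| #|` fset_set (@torsion (quot_char_span chi (f @: 'I_k)))|%:Z)%Z
  <-> minors_dvd k c A.
Proof.
have [P Pu [Q Qu [d d_sorted AE]]] := int_Smith_normal_form A.
rewrite -/(smith_mx k n d) in AE.
have A_indep' := A_indep; rewrite AE in A_indep'.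
have [kn d0] := smith_indep Pu A_indep'.
rewrite AE minors_dvd_equiv // minors_dvd_smith //.
suff -> : #|` fset_set (@torsion (quot_char_span chi (f @: 'I_k)))| =
    (\prod_(i < k) absz (d`_i)%R)%N.
  have -> : (c %| \prod_(i < k) d`_i)%Z = (absz c %| absz (\prod_(i < k) d`_i)%R)%N by [].
  by rewrite (big_morph absz abszM (erefl _)).
have matrixB_entry (u w : 'rV[int]_n) j : (u - w) 0 j = u 0 j - w 0 j.
  by rewrite mxE [X in _ + X]mxE.
pose wd := widen_ord kn.
(* Coordinates in the adapted basis: the span is d_a Z in the first [k] directions and 0 in the
   others. *)
pose Y l := psi l *m invmx Q.
have YB l m : Y (l - m) = Y l - Y m by rewrite /Y raddfB mulmxBl.
have YMn l m : Y (l *+ m) = Y l *+ m.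
  by rewrite /Y raddfMn; exact: (raddfMn (mulmxr (invmx Q))).
have spanE l : l \in char_span chi (f @: 'I_k) <->
    (forall j : 'I_n, (k <= j)%N -> Y l 0 j = 0) /\
    (forall a : 'I_k, (d`_a %| Y l 0%R (wd a))%Z).
  split=> [/char_span_rowsE[w wE]|[Y0 dY]].
    have -> : Y l = (w *m P) *m smith_mx k n d.
      by rewrite /Y wE AE !mulmxA mulmxK.
    split=> [j kj|a]; first exact: smith_mul0.
    by rewrite (@smith_mulE _ _ _ _ a) // dvdz_mull.
  apply/char_span_rowsE.
  exists ((\row_a (Y l 0%R (wd a) %/ d`_a)%Z) *m invmx P); rewrite AE !mulmxA mulmxKV //.
  apply: (canRL (mulmxKV Qu)); apply/rowP => j.
  have [kj|jk] := leqP k j; first by rewrite smith_mul0 // -/(Y l) Y0.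
  rewrite (@smith_mulE _ _ _ _ (Ordinal jk)) // mxE divzK //.
  by congr (Y l 0 _); apply: val_inj.
(* Multiplying by all the |d_a| achieves the divisibilities, so only the vanishing conditions
   remain. *)
have radE l : l \in radical chi (f @: 'I_k) <->
    (forall j : 'I_n, (k <= j)%N -> Y l 0 j = 0).
  split=> [/radicalP[m m0 /spanE[Y0 _]] j kj|Y0].
    have /eqP := Y0 j kj; rewrite YMn mulmxnE mulrn_eq0 gtn_eqF //= => /eqP.
    by [].
  apply/radicalP; exists (\prod_(a < k) absz (d`_a)%R)%N.
    by apply: prodn_gt0 => a; rewrite absz_gt0.
  apply/spanE; rewrite YMn; split=> [j kj|a]; rewrite mulmxnE.
    by rewrite Y0 // mul0rn.
  rewrite (bigD1 a) //= mulrnA -[_ *+ absz _]mulr_natr natz.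
  by apply: rpredMn; rewrite dvdz_mull // dvdzE /= .
(* Families of residues below |d_a| represent each torsion class exactly once. *)
pose T : finType := {dffun forall a : 'I_k, 'I_(absz d`_a)}.
have -> : (\prod_(i < k) absz (d`_i)%R)%N = #|{: T}|.
  rewrite card_dep_ffun foldrE big_map big_enum /=.
  by apply: eq_bigr => a _; rewrite card_ord.
pose v (t : T) : 'rV[int]_n :=
  \row_j if insub (val j) is Some a then (t a : nat)%:Z else 0.
have [psi' psiK psi'K] := psi_bij.
have Yv t : Y (psi' (v t *m Q)) = v t by rewrite /Y psi'K mulmxK.
have vlt t a : v t 0 (wd a) = (t a : nat)%:Z by rewrite mxE /= valK.
have vge t (j : 'I_n) : (k <= j)%N -> v t 0 j = 0.
  by move=> kj; rewrite mxE insubF // ltnNge kj.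
pose F (t : T) : quot_char_span chi (f @: 'I_k) :=
  (\pi_(Quotient.quot (char_span chi (f @: 'I_k))) (psi' (v t *m Q)))%qT.
have F_inj : injective F.
  move=> s t /eqP; rewrite quot_piE => /spanE[_]; rewrite YB !Yv => dst.
  apply/ffunP => a; apply: val_inj => /=.
  have : ((absz d`_a)%:Z %| (s a : nat)%:Z - (t a : nat)%:Z)%Z.
    have -> : (s a : nat)%:Z - (t a : nat)%:Z = (v s - v t) 0 (wd a).
      by rewrite matrixB_entry !vlt.
    exact: dst.
  by rewrite -eqz_mod_dvd !modz_small ?ltz_nat ?ltn_ord //= => /eqP[].
have FE : (range F = @torsion (quot_char_span chi (f @: 'I_k)))%classic.
  apply/seteqP; split=> [_ [t _ <-]|q qt].
    by apply/torsion_quotP/radE => j kj; rewrite Yv vge.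
  have := reprK (q : Quotient.quot (char_span chi (f @: 'I_k))).
  move: (generic_quotient.repr _) => m mq; rewrite -mq in qt *.
  move/torsion_quotP/radE : qt => Y0.
  have rlt a : (absz (Y m 0%R (wd a) %% d`_a)%Z < absz (d`_a)%R)%N.
    by rewrite -ltz_nat gez0_abs ?modz_ge0 ?abszE ?ltz_mod.
  exists [ffun a => Ordinal (rlt a)] => //.
  apply/eqP; rewrite quot_piE; apply/spanE; rewrite YB Yv; split=> [j kj|a].
    by rewrite matrixB_entry vge // Y0 // subr0.
  rewrite matrixB_entry vlt ffunE /= gez0_abs ?modz_ge0 //.
  rewrite [X in _ - X](divz_eq _ d`_a) opprD addrCA subrr addr0.
  by rewrite rpredN dvdz_mull.
have fin : finite_set (@torsion (quot_char_span chi (f @: 'I_k))).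
  by rewrite -FE; exact/finite_image/finite_finset.
have -> : fset_set (@torsion (quot_char_span chi (f @: 'I_k))) = [fset F t | t : T]%fset.
  rewrite -FE; apply/fsetP => q; rewrite in_fset_set; last by rewrite FE.
  apply/idP/imfsetP => /=; rewrite ?inE.
    by move=> [t _ <-]; exists t.
  by move=> [t _ ->]; exists t.
by rewrite card_imfset //= -cardE.
Qed.

End TorsionMinors.

(** Equal determinantal divisors give equal products of the leading invariant factors up to sign;
    cancelling the nonzero shorter product gives each factor up to sign. *)
Lemma smith_equiv n (B B' : 'M[int]_n) : row_indep B -> row_indep B' ->
  (forall k c, minors_dvd k c B <-> minors_dvd k c B') ->
  exists P Q : 'M[int]_n, [/\ P \in unitmx, Q \in unitmx & B' = P *m B *m Q].
Proof.
have [L Lu [R Ru [d d_sorted ->]]] := int_Smith_normal_form B.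
have [L' L'u [R' R'u [d' d'_sorted ->]]] := int_Smith_normal_form B'.
rewrite -!/(smith_mx _ _ _) => /(smith_indep Lu)[_ d0] /(smith_indep L'u)[_ d'0] eqm.
have prodE k : (k <= n)%N ->
    absz (\prod_(i < k) d`_i) = absz (\prod_(i < k) d'`_i).
  move=> kn; apply/eqP; rewrite eqn_dvd; apply/andP; split.
    suff : (\prod_(i < k) d`_i %| \prod_(i < k) d'`_i)%Z by [].
    apply/(minors_dvd_smith _ d'_sorted kn kn)/(minors_dvd_equiv _ _ _ L'u R'u)/eqm.
    by apply/(minors_dvd_equiv _ _ _ Lu Ru)/(minors_dvd_smith _ d_sorted kn kn).
  suff : (\prod_(i < k) d'`_i %| \prod_(i < k) d`_i)%Z by [].
  apply/(minors_dvd_smith _ d_sorted kn kn)/(minors_dvd_equiv _ _ _ Lu Ru)/eqm.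
  by apply/(minors_dvd_equiv _ _ _ L'u R'u)/(minors_dvd_smith _ d'_sorted kn kn).
have dE (i : 'I_n) : absz d`_i = absz d'`_i.
  have := prodE i.+1 (ltn_ord i).
  rewrite !big_ord_recr !abszM /= (prodE i (ltnW (ltn_ord i))) => /eqP.
  rewrite eqn_pmul2l => [/eqP//|].
  rewrite absz_gt0; apply/prodf_neq0 => j _.
  exact: (d'0 (widen_ord (ltnW (ltn_ord i)) j)).
(* The remaining signs form an invertible diagonal matrix. *)
pose u : 'rV[int]_n := \row_i if d`_i == d'`_i then 1 else -1.
have Uu : diag_mx u \in unitmx.
  rewrite unitmxE det_diag; apply: rpred_prod => i _; rewrite mxE.
  by case: ifP; rewrite ?unitrN ?unitr1.
have DE : smith_mx n n d' = smith_mx n n d *m diag_mx u.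
  apply/matrixP => i j; rewrite mul_mx_diag !mxE.
  have [<-|_] := eqVneq (i : nat) j; last by rewrite mul0r.
  rewrite !mulr1n; case: ifP => [/eqP->|]; first by rewrite mulr1.
  have : (`|d`_i| == `|d'`_i|)%R by rewrite -!abszE dE.
  by rewrite eqr_norm2 => /orP[->//|/eqP->] _; rewrite mulrN1 opprK.
exists (L' *m invmx L), (invmx R *m diag_mx u *m R'); split.
- by rewrite unitmx_mul L'u unitmx_inv.
- by rewrite !unitmx_mul unitmx_inv Ru Uu.
by rewrite DE !mulmxA mulmxKV // mulmxK.
Qed.

(** * Recovering the cokernel from the multiplicities *)

Section Cokernel.
Variables (E : finType) (Gam : zmodType) (chi : E -> Gam) (n : nat).
Variables (fG : {additive Gam -> 'rV[int]_n}) (fG_bij : bijective fG).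
Hypothesis chi_gen : forall c, c \in char_span chi [set: E]%SET.

Section InclusionMatrix.
Variables (L : zmodType) (i : {additive Gam -> L}) (psi : {additive L -> 'rV[int]_n}).
Hypotheses (i_inj : injective i) (psi_bij : bijective psi).
Variable B : 'M[int]_n.
Hypothesis BE : forall c, psi (i c) = fG c *m B.

Lemma inclusion_indep : row_indep B.
Proof.
have [g gK fK] := fG_bij => v vB.
have : psi (i (g v)) = psi (i 0) by rewrite !BE fK vB raddf0 mul0mx.
by move=> /(bij_inj psi_bij)/i_inj g0; rewrite -[v]fK g0 raddf0.
Qed.

(** The characters generate [Gam], so their coordinate matrix [X] has a left inverse [Z], and the
    minors of B = Z (X B) are controlled by those of [X B], whose rows are the lifted characters. *)
Lemma minors_dvd_inclusion k c :
  minors_dvd k c B <->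
  forall f : 'I_k -> E, row_indep (\matrix_a fG (chi (f a))) ->
    (c %| #|` fset_set (@torsion (quot_char_span (i \o chi) (f @: 'I_k)))|%:Z)%Z.
Proof.
pose X := \matrix_(a < #|E|) fG (chi (enum_val a)).
have subE (f : 'I_k -> E) :
    \matrix_a psi ((i \o chi) (f a)) = (\matrix_a fG (chi (f a))) *m B.
  by apply/row_matrixP => a; rewrite row_mul !rowK /= BE.
have indE (f : 'I_k -> E) : row_indep (\matrix_a fG (chi (f a))) ->
    row_indep (\matrix_a psi ((i \o chi) (f a))).
  by move=> ind v; rewrite subE mulmxA => /inclusion_indep/ind.
have [Z ZX] : exists Z, Z *m X = 1%:M.
  have /choice[z zE] (j : 'I_n) : exists z : 'rV_#|E|, z *m X = delta_mx 0 j.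
    have [g gK fK] := fG_bij.
    have /char_spanP[b bE] := chi_gen (g (delta_mx 0 j)).
    exists (\row_a b (enum_val a)); rewrite -[RHS]fK bE raddf_sum mulmx_sum_row.
    rewrite [RHS](reindex (fun a : 'I_#|E| => enum_val a)) /=; last first.
      exact/onW_bij/enum_val_bij.
    apply: eq_big => [a|a _]; first by rewrite finset.in_setT.
    by rewrite rowK mxE -[b _]intz scaler_int intz raddfMz.
  exists (\matrix_j z j); apply/row_matrixP => j.
  by rewrite row_mul rowK zE rowE mulmx1.
split=> [cB f ind|cE].
  apply/(card_torsion_minors psi_bij (indE f ind)).
  by rewrite subE; exact: minors_dvd_mull.
rewrite -[B]mul1mx -ZX -mulmxA; apply: minors_dvd_mull => f' g.
pose f a := enum_val (f' a).
have -> : mxsub f' g (X *m B) = mxsub id g (\matrix_a psi ((i \o chi) (f a))).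
  rewrite subE; apply/matrixP => a b; rewrite !mxE.
  by apply: eq_bigr => l _; rewrite !mxE.
(* Independent characters have minors governed by a multiplicity; for dependent ones the minors are
   0. *)
have [ind|dep] := EM (row_indep (\matrix_a fG (chi (f a)))).
  exact: (card_torsion_minors psi_bij (indE f ind) c).1 (cE f ind) id g.
rewrite subE; apply: minors_dvd_mulr; exact: minors_dependent.
Qed.

End InclusionMatrix.

(** The inclusion matrices satisfy B' = P B Q, so right multiplication by the inverse of [Q] carries
    the image of [Gam] in [L'] onto that in [L]; [p'] is [p] after this isomorphism. *)
Lemma cokernel_projection (L L' : zmodType) (i : {additive Gam -> L})
    (i' : {additive Gam -> L'}) (psi : {additive L -> 'rV[int]_n})
    (psi' : {additive L' -> 'rV[int]_n}) (G : zmodType) (p : {additive L -> G}) :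
  injective i -> injective i' -> bijective psi -> bijective psi' ->
  (forall S, #|` fset_set (@torsion (quot_char_span (i \o chi) S))| =
             #|` fset_set (@torsion (quot_char_span (i' \o chi) S))|) ->
  (forall g, exists l, p l = g) -> (forall l, p l = 0 <-> exists c, l = i c) ->
  exists p' : {additive L' -> G},
    (forall g, exists l, p' l = g) /\ (forall l, p' l = 0 <-> exists c, l = i' c).
Proof.
move=> i_inj i'_inj psi_bij psi'_bij cardE p_surj p_ker.
have [g [gK fK]] := additive_inverse fG_bij.
have [q [qK psiK]] := additive_inverse psi_bij.
have [q' [q'K psi'K]] := additive_inverse psi'_bij.
have [B BE0] := additive_mx (psi \o i \o g).
have [B' BE0'] := additive_mx (psi' \o i' \o g).
have BE c : psi (i c) = fG c *m B by rewrite -BE0 /= gK.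
have BE' c : psi' (i' c) = fG c *m B' by rewrite -BE0' /= gK.
have [|||P [Q [Pu Qu B'E]]] := @smith_equiv n B B'.
- exact: inclusion_indep BE.
- exact: inclusion_indep BE'.
- move=> k c; rewrite (minors_dvd_inclusion i_inj psi_bij BE).
  rewrite (minors_dvd_inclusion i'_inj psi'_bij BE').
  by split=> H f /H; rewrite cardE.
pose p'0 l := p (q (psi' l *m invmx Q)).
have [l m|p' p'E] := additive_of_morphism (h := p'0).
  by rewrite /p'0 raddfB mulmxBl !raddfB.
exists p'; split=> [h|l]; rewrite ?p'E /p'0.
  have [l lh] := p_surj h; exists (q' (psi l *m Q)).
  by rewrite p'E /p'0 psi'K mulmxK // qK.
rewrite p_ker; split=> [[c cE]|[c ->]].
  exists (g (fG c *m invmx P)); apply: (bij_inj psi'_bij).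
  rewrite BE' fK B'E !mulmxA mulmxKV // -BE -cE psiK mulmxKV //.
exists (g (fG c *m P)); apply: (bij_inj psi_bij).
by rewrite psiK BE' BE fK B'E !mulmxA mulmxK.
Qed.

End Cokernel.

(** The empty family spans 0, so this cardinality counts the torsion of [L] itself. *)
Lemma torsion_free_card (E : finType) (L : zmodType) (chi : E -> L) :
  fin_gen L ->
  #|` fset_set (@torsion (quot_char_span chi finset.set0))| = 1%N <->
  forall l : L, torsion l -> l = 0.
Proof.
move=> Lfg.
have fin : finite_set (@torsion (quot_char_span chi finset.set0)).
  exact/finite_torsion/fin_gen_quot.
have span0 l : l \in char_span chi finset.set0 -> l = 0.
  by case/char_spanP => c ->; rewrite finset.big_set0.
split=> [/eqP/cardfs1P[q qE] l [k k0 lk]|tf].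
  have quot_tors m : m \in radical chi finset.set0 ->
      (\pi_(Quotient.quot (char_span chi finset.set0)) m)%qT = q.
    by move=> /torsion_quotP mt; apply/eqP; rewrite -in_fset1 -qE in_fset_set // inE.
  apply: span0; rewrite -[l]subr0 -quot_piE !quot_tors ?rpred0 //.
  by apply/radicalP; exists k; rewrite // lk rpred0.
rewrite (_ : fset_set _ = [fset 0]%fset) ?cardfs1 //; apply/fsetP => q.
rewrite in_fset_set // in_fset1; apply/idP/eqP => [|->]; rewrite inE; last by exists 1%N.
rewrite -[q](reprK (q : Quotient.quot (char_span chi finset.set0))).
move=> /torsion_quotP/radicalP[k k0 /span0 lk].
by rewrite (tf (generic_quotient.repr _)) ?raddf0 //; exists k.
Qed.

Lemma free_fin_rank_torsion (L : zmodType) (l : L) :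
  free_fin_rank L -> torsion l -> l = 0.
Proof.
move=> [n [f f_bij]] [k k0 lk]; apply: (bij_inj f_bij); rewrite raddf0.
apply/rowP => j; have := congr1 (fun m => f m 0 j) lk.
rewrite raddf0 raddfMn mulmxnE mxE => /eqP.
by rewrite mulrn_eq0 gtn_eqF //= => /eqP.
Qed.

(** * The bijection between orbits and coverings *)

Theorem theorem5p6 (R : realType) (Gam : zmodType) (T : torus_over R Gam)
    (G : finZmodType) (p : {additive chars T -> G})
    (E : finType) (D : arrangement R Gam E)
    (Gam_free : free_fin_rank Gam) (Lam_free : free_fin_rank (chars T))
    (T_cov : covering T)
    (p_surj : forall g, exists l, p l = g)
    (p_ker : forall l, p l = 0 <-> exists c, l = pull_char T c)
    (D_toric : toric_arrangement D) (D_surj : surjective_arrangement D) :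
  let mT := multiplicity (lift_arrangement D T) in
  exists Phi : quot_set (coherent D mT) (@same_orbit G Gam) ->
               quot_set (covering_with_multiplicity D mT) (@iso_over R Gam),
    bijective Phi /\
    forall (x : Ext1 G Gam) (Cx : coherent D mT x),
      sval (Phi (quot_class (@same_orbit G Gam) Cx)) (extension_torus R x).
Proof.
move=> mT.
have Gfg := free_fin_rank_gen Gam_free.
apply: (@quot_set_bijection _ _ _ _ _ _ (extension_torus R (G := G) (Gam := Gam))).
- exact: iso_over_refl.
- exact: iso_over_sym.
- exact: iso_over_trans.
- by move=> x Cx; split; [exact: extension_torus_covering|exact/coherentE].
- by move=> x y; exact: same_orbit_iso_over.
move=> Y [Ycov Ym].
have [[Tfg _ _ _] [Yfg _ _ _]] := (T_cov, Ycov).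
have [i [iE _ i_inj [N N0 NT]]] := covering_inclusion Gfg T_cov.
have [j [jE jY j_inj [N' N'0 NY]]] := covering_inclusion Gfg Ycov.
have cardE S : #|` fset_set (@torsion (quot_char_span (i \o charac D) S))| =
    #|` fset_set (@torsion (quot_char_span (j \o charac D) S))|.
  rewrite (_ : i \o _ = charac (lift_arrangement D T)).
    2: by apply/funext => e; exact: iE.
  rewrite (_ : j \o _ = charac (lift_arrangement D Y)).
    2: by apply/funext => e; exact: jE.
  by rewrite -/(multiplicity _ S) -/(multiplicity _ S) Ym.
have T_tf (l : chars T) : torsion l -> l = 0 by exact: free_fin_rank_torsion.
(* The multiplicity of the empty set is 1 for [T], hence for [Y], whose character group is therefore
   a lattice. *)
have Y_tf : forall l : chars Y, torsion l -> l = 0.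
  apply/(torsion_free_card (j \o charac D)) => //; rewrite -cardE.
  exact/torsion_free_card.
have [n [fG fG_bij]] := Gam_free.
(* Both character groups receive bases of the same length [n] as [Gam], which makes the inclusion
   matrices square. *)
have [psi psi_bij] := lattice_basis fG_bij i_inj Tfg T_tf N0 NT.
have [psi' psi'_bij] := lattice_basis fG_bij j_inj Yfg Y_tf N'0 NY.
have [|p' [p'_surj p'_ker]] := cokernel_projection fG_bij D_surj i_inj j_inj
    psi_bij psi'_bij cardE p_surj.
  move=> l; apply: iff_trans (p_ker l) _.
  by split=> -[c ->]; exists c; rewrite iE.
(* With cokernel [G] identified, the character group of [Y] is an extension of [G] by [Gam]; its
   class is the preimage sought. *)
have [x [h [h_bij h_incl]]] := extension_class_exists j_inj p'_surj p'_ker.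
have Yx : iso_over Y (extension_torus R x).
  apply: (@iso_over_additive _ _ Y (extension_torus R x) h) => // t c.
  by rewrite jY /= h_incl.
exists x; last exact: iso_over_sym.
apply/coherentE => // S; rewrite -Ym; apply/esym.
apply: multiplicity_iso_over => //; exact: extension_torus_covering.
Qed.
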